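(* Let $k\ge1$ be an integer and $\lambda>0$. There exists a real number $\xi(k,\lambda)$ such that $q_n\approx e^{-n\xi(k,\lambda)}$, that is, $$\lim_{n\to\infty}\frac{\log q_n}{n}=-\xi(k,\lambda),\qquad\text{where } q_n=\sup_{\Gamma_0\text{ nice}}\mathbf E^{\Gamma_0}[Z_n^\lambda].$$
   Context: Cylinder and walk. Let $d,L\ge1$ be integers, $\mathbb T=(\mathbb Z/L\mathbb Z)^{d-1}$, $G=\mathbb Z\times\mathbb T$ with nearest-neighbour graph structure. For $z=(i,y)\in G$ write $|z|=i$ (the level of $z$), and $G_j=\{z:|z|\le j\}$. Fix $1/2<p<1$. The random walk jumps from $z$ to $z+(1,0)$ with probability $p/d$, to $z-(1,0)$ with probability $(1-p)/d$, and to $z+(0,e)$ with probability $1/(2d)$ for each of the $2(d-1)$ unit vectors $e=\pm e_i$ of the torus. Paths. $\mathcal X_i$ is the set of finite nearest-neighbour paths starting on level $i-1$ and ending when first reaching level $i$. $\mathcal A_n$ is the set of half-infinite concatenations $\overline\gamma_n=\dots\gamma_{n-1}\gamma_n$ with $\gamma_j\in\mathcal X_j$, the endpoint of $\gamma_j$ being the starting point of $\gamma_{j+1}$; $\mathcal A=\mathcal A_0$. Paths are identified with their sets of visited sites when intersections are taken. Initial configurations and $Z_n$. Let $\Gamma_0=(\overline\gamma_0^1,\dots,\overline\gamma_0^k)\in\mathcal A^k$. To the endpoint of each $\overline\gamma_0^j$ attach an independent random walk $S^j$ run until it first reaches level $n$; this gives $\overline\gamma_n^j\in\mathcal A_n$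 and $\Gamma_n=(\overline\gamma_n^1,\dots,\overline\gamma_n^k)$, also regarded as the union of the visited sites. $\mathbf E^{\Gamma_0}$ is expectation over the attached walks. With $S$ another independent walk started at $x$ under $\mathbf P_1^x$ and $T_r=\inf\{t:|S_t|=r\}$, define $$Z_n=\lim_{|x|\to-\infty}\mathbf P_1^x\{S[0,T_n]\cap\Gamma_n=\emptyset\mid S[0,T_0]\cap\Gamma_0=\emptyset\},$$ the limit being over starting points $x$ for which the conditioning event has positive probability. $\Gamma_0$ is called nice if such $x$ exist on arbitrarily low levels and the limit exists (for all $n$ and all extensions $\Gamma_n$). For $k=1$, ''nice'' is taken to mean the following explicit condition, which ensures that the limit exists: $D(\overline\gamma_0)$, the connected component of $G_0\setminus\overline\gamma_0$ connecting level $0$ to $-\infty$, is non-empty, and for all $n\ge0$ there is $m>n$ with $\sum_{j=-m}^{-1}1\{D_j\text{ is connected}\}\ge n$, where $D_j$ is the set of sites of $D(\overline\gamma_0)$ on level $j$. It is assumed that nice configurations exist. *)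

(* Defs.v *)
From HB Require Import structures.
From mathcomp Require Import all_boot all_order all_algebra.
From mathcomp Require Import all_classical all_reals all_analysis.

Set Implicit Arguments.
Unset Strict Implicit.
Unset Printing Implicit Defensive.

Import Order.TTheory GRing.Theory Num.Theory.
Import numFieldNormedType.Exports.

Local Open Scope classical_set_scope.
Local Open Scope ring_scope.

(* 'I_L.-1.+1 is the additive group Z/LZ for every L >= 1; unlike 'Z_L it is
   the trivial group for L = 1. *)
Definition torus (d L : nat) := {ffun 'I_d.-1 -> 'I_L.-1.+1}.

Definition site (d L : nat) := (int * torus d L)%type.

Definition level d L (z : site d L) : int := z.1.

Definition up d L : site d L := (1, 0).

(* inZp 1 is the class of 1 mod L, which is 0 when L = 1 *)
Definition side d L (i : 'I_d.-1) : site d L :=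
  (0, [ffun j => if j == i then inZp 1 else 0]).
Arguments side {d L} i.

(* For L = 1 a torus step is a self-loop and the walk may stay put; for L = 2
   the steps in directions e and -e lead to the same site, and their
   probabilities add up in [step]. *)
Definition adj d L : rel (site d L) := fun z w =>
  [|| w == z + up d L, w == z - up d L |
      [exists i : 'I_d.-1, (w == z + side i) || (w == z - side i)]].

Definition step (R : realType) d L (p : R) (z w : site d L) : R :=
  p / d%:R * (w == z + up d L)%:R
  + (1 - p) / d%:R * (w == z - up d L)%:R
  + \sum_(i < d.-1) (2 * d%:R)^-1 *
      ((w == z + side i)%:R + (w == z - side i)%:R).

Definition random_walk (R : realType) d L (p : R) (disp : measure_display)
    (Om : measurableType disp) (P : probability Om R)
    (S : nat -> Om -> site d L) (x : site d L) : Prop :=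
  (forall t z, measurable [set w | S t w = z]) /\
  (forall m (g : nat -> site d L),
     P [set w | forall t, (t <= m)%N -> S t w = g t]
     = ((g 0%N == x)%:R * \prod_(t < m) step p (g t) (g t.+1))%:E).

(* Since the state space is countable, the product rule on cylinder events
   determines the joint law (a subfamily is obtained by summing over the
   trajectories of the other walks). *)
Definition independent_walks (R : realType) d L (p : R) k
    (disp : measure_display) (Om : measurableType disp) (P : probability Om R)
    (S : 'I_k -> nat -> Om -> site d L) (x : 'I_k -> site d L) : Prop :=
  (forall i, random_walk p P (S i) (x i)) /\
  (forall m (g : 'I_k -> nat -> site d L),
     P [set w | forall i t, (t <= m)%N -> S i t w = g i t]
     = (\prod_(i < k)
          fine (P [set w | forall t, (t <= m)%N -> S i t w = g i t]))%:E).

(* The set X_i of crossings from level i-1 to level i. *)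
Definition crossing d L (i : int) (s : seq (site d L)) : bool :=
  if s is z :: s' then
    [&& level z == i - 1, path (@adj d L) z s', level (last z s') == i
      & all (fun w => level w != i) (belast z s')]
  else false.

Definition start d L (s : seq (site d L)) : site d L := head 0 s.
Definition finish d L (s : seq (site d L)) : site d L := last 0 s.

(* Membership of ... gam (n-1), gam n in A_n; the values gam j with j > n
   are irrelevant. *)
Definition half_infinite d L (n : int) (gam : int -> seq (site d L)) : Prop :=
  forall j : int, j <= n ->
    crossing j (gam j) /\ finish (gam (j - 1)) = start (gam j).

Definition trace0 d L (gam : int -> seq (site d L)) : set (site d L) :=
  [set z | exists2 j : int, j <= 0 & z \in gam j].

(* S[0, T_r] for a trajectory s: t <= T_r means that level r is not visited
   strictly before time t. *)
Definition visited d L (r : int) (s : nat -> site d L) : set (site d L) :=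
  [set s t | t in [set t | forall u, (u < t)%N -> level (s u) <> r]].

Definition configuration d L k (Gam : 'I_k -> int -> seq (site d L)) : Prop :=
  forall i, half_infinite 0 (Gam i).

Definition sites0 d L k (Gam : 'I_k -> int -> seq (site d L)) :
    set (site d L) :=
  \bigcup_(i in [set: 'I_k]) trace0 (Gam i).

Definition endpoints d L k (Gam : 'I_k -> int -> seq (site d L)) :
    'I_k -> site d L :=
  fun i => finish (Gam i 0).

(* The union of visited sites of Gam_n, when the trajectory s i is attached to
   the endpoint of the i-th path of Gam_0 and followed until it first reaches
   level n. If level n is never reached (a null event for the walks, as
   1/2 < p), the whole trajectory is attached. *)
Definition extend d L k (Gam : 'I_k -> int -> seq (site d L)) (n : nat)
    (s : 'I_k -> nat -> site d L) : set (site d L) :=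
  sites0 Gam `|` \bigcup_(i in [set: 'I_k]) visited n%:Z (s i).

Definition is_extension d L k (Gam : 'I_k -> int -> seq (site d L)) (n : nat)
    (s : 'I_k -> nat -> site d L) : Prop :=
  forall i, [/\ s i 0%N = endpoints Gam i,
    forall t, adj (s i t) (s i t.+1) & exists t, level (s i t) = n%:Z].

Definition avoids d L (Om : Type) (S : nat -> Om -> site d L) (r : int)
    (A : set (site d L)) : set Om :=
  [set w | visited r (S ^~ w) `&` A = set0].

Definition cond_prob (R : realType) (disp : measure_display)
    (Om : measurableType disp) (P : probability Om R) (A B : set Om) : R :=
  fine (P (A `&` B)) / fine (P B).

Definition level_to_ninfty d L : set_system (site d L) :=
  filter_from [set: nat] (fun m => [set x | level x <= - m%:Z]).

Definition admissible (R : realType) d L (disp : measure_display)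
    (Om : measurableType disp) (P1 : site d L -> probability Om R)
    (S : nat -> Om -> site d L) (A0 : set (site d L)) : set (site d L) :=
  [set x | (0 < P1 x (avoids S 0 A0))%E].

(* The function of the starting point x whose limit as |x| -> -oo is Z_n,
   along the filter of which the limit is taken. *)
Definition Zfilter (R : realType) d L (disp : measure_display)
    (Om : measurableType disp) (P1 : site d L -> probability Om R)
    (S : nat -> Om -> site d L) (n : nat) (A0 An : set (site d L)) :
    set_system R :=
  (fun x => cond_prob (P1 x) (avoids S n%:Z An) (avoids S 0 A0))
    @ within (admissible P1 S A0) (@level_to_ninfty d L).

Definition Zlim (R : realType) d L (disp : measure_display)
    (Om : measurableType disp) (P1 : site d L -> probability Om R)
    (S : nat -> Om -> site d L) (n : nat) (A0 An : set (site d L)) : R :=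
  lim (Zfilter P1 S n A0 An).

Definition connected_in d L (A : set (site d L)) (z w : site d L) : Prop :=
  exists s, [/\ path (@adj d L) z s, last z s = w
              & forall v, v \in z :: s -> A v].

(* The sites of G_0 minus gam connected to level 0 and to -oo. There is at most
   one such component: gam has a single site on level 0, and a torus minus a
   point is connected. *)
Definition free_component d L (gam : int -> seq (site d L)) :
    set (site d L) :=
  let A := [set z | level z <= 0] `\` trace0 gam in
  [set z | (exists2 w, level w = 0 & connected_in A z w) /\
           (forall m : nat, exists2 w, level w <= - m%:Z & connected_in A z w)].

Definition slice d L (A : set (site d L)) (j : int) : set (site d L) :=
  A `&` [set z | level z = j].

Definition graph_connected d L (A : set (site d L)) : Prop :=
  forall z w, A z -> A w -> connected_in A z w.

Definition nice1 d L (gam : int -> seq (site d L)) : Prop :=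
  let D := free_component gam in
  D !=set0 /\
  forall n : nat, exists2 m : nat, (n < m)%N &
    (n <= \sum_(1 <= j < m.+1) `[< graph_connected (slice D (- j%:Z)) >])%N.

Definition nice_limit (R : realType) d L (disp : measure_display)
    (Om : measurableType disp) (P1 : site d L -> probability Om R)
    (S : nat -> Om -> site d L) k (Gam : 'I_k -> int -> seq (site d L)) :
    Prop :=
  (forall m : nat, exists2 x, level x <= - m%:Z
                            & admissible P1 S (sites0 Gam) x) /\
  (forall n s, is_extension Gam n s ->
     cvg (Zfilter P1 S n (sites0 Gam) (extend Gam n s))).

Definition nice (R : realType) d L (disp : measure_display)
    (Om : measurableType disp) (P1 : site d L -> probability Om R)
    (S : nat -> Om -> site d L) k (Gam : 'I_k -> int -> seq (site d L)) :
    Prop :=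
  configuration Gam /\
  (if k == 1%N then forall i, nice1 (Gam i) else nice_limit P1 S Gam).

(* E^{Gam_0}[Z_n^lam]: the i-th walk W i starts at the endpoint of Gam i. *)
Definition EZ (R : realType) d L (disp1 : measure_display)
    (Om1 : measurableType disp1) (P1 : site d L -> probability Om1 R)
    (S : nat -> Om1 -> site d L) k (disp : measure_display)
    (Om : measurableType disp) (P : ('I_k -> site d L) -> probability Om R)
    (W : 'I_k -> nat -> Om -> site d L) (lam : R) (n : nat)
    (Gam : 'I_k -> int -> seq (site d L)) : \bar R :=
  ('E_(P (endpoints Gam))
     [(fun w => Zlim P1 S n (sites0 Gam) (extend Gam n (fun i t => W i t w))
               `^ lam)%R])%E.

Definition q (R : realType) d L (disp1 : measure_display)
    (Om1 : measurableType disp1) (P1 : site d L -> probability Om1 R)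
    (S : nat -> Om1 -> site d L) k (disp : measure_display)
    (Om : measurableType disp) (P : ('I_k -> site d L) -> probability Om R)
    (W : 'I_k -> nat -> Om -> site d L) (lam : R) (n : nat) : \bar R :=
  ereal_sup [set EZ P1 S P W lam n Gam | Gam in @nice R d L disp1 Om1 P1 S k].

(* Main.v *)
Require Import Defs.
From mathcomp Require Import all_boot all_order all_algebra.
From mathcomp Require Import all_classical all_reals all_analysis.
From mathcomp Require Import measurable_realfun.
From mathcomp Require Import zify ring lra.
Import Order.TTheory GRing.Theory Num.Theory.
Import numFieldNormedType.Exports.
Set Implicit Arguments.
Unset Strict Implicit.
Unset Printing Implicit Defensive.
Local Open Scope classical_set_scope.
Local Open Scope ring_scope.

(** The exponent is that of a submultiplicative sequence: [q (n + m) <= q n * q m]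
    and [c ^ n <= q n <= 1] for some [c > 0], so that [log (q n) / n] converges to
    its infimum, a real number ([fekete]).

    Submultiplicativity comes from conditioning in stages. Extend a nice
    configuration to level 1 by the attached walks and look at the result from
    level 1, that is, shift it down by one level ([advance]). The probability of
    avoiding the paths up to level [n + 1], given that they are avoided up to
    level 0, is the product of the same probability for level 1 and of the
    conditional probability of going on, and the latter is the quantity [Z_n] of
    the new configuration ([advance_cvg], [Zpath_cat]). If [Z_1 > 0] the new
    configuration is nice ([advance_nice]); if [Z_1 = 0] it need not be, but then
    [Z_(n+1) = 0] too and it does not contribute. With the Markov property of the
    attached walks ([EZ_advance]) this gives
    [E Z_(n+1)^lam = E (Z_1^lam * E' Z_n^lam)], where [E'] is the expectation for
    the new configuration, and iteration over the levels gives
    [E Z_(n+m)^lam <= E Z_n^lam * q m]. For the lower bound, both the attached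
    walks and the free walk may go straight up: on level 0 the free walk is off
    the endpoints of the paths, so it stays off the extended paths
    ([straight_Zpath_ge]).

    For one path niceness is a geometric condition, and the existence of the limit
    has to be proved. Avoidance probabilities are harmonic for the walk that
    avoids the path. Between two sites of a connected slice the walk can move
    inside the slice at a bounded cost, which is a Harnack inequality; hence every
    connected slice narrows the range of the ratio of two such functions by a fixed
    factor ([slice_contraction]), and a nice path has infinitely many connected
    slices ([ratio_cvg]). The extension of the path is finite, so far down the
    connected slices of the new path are those of the old one
    ([often_connected_extend]).

    All probabilities are turned into sums over finite paths. Because of the drift
    the walk almost surely reaches every higher level ([passage_mass_ge1]), so
    that [S[0, T_r]] is a random element of the countable set of first-passage
    paths, and the strong Markov property is the bijection between first-passage
    paths to level [n] and pairs of successive first-passage paths, to [r] and then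
    from there to [n] ([free_passages_split], [joint_passages_cat]). *)

(** * Jumps of the walk *)

(** [inl true] and [inl false] are the jumps up and down. Jumps are counted with
    multiplicity: for [L <= 2] different jumps may lead to the same site. *)
Definition jump (d : nat) := (bool + 'I_d.-1 * bool)%type.

Section Jumps.
Variables (R : realType) (d L : nat) (p : R).
Local Notation site := (site d L).

Definition displacement (m : jump d) : site :=
  match m with
  | inl b => if b then up d L else - up d L
  | inr (i, b) => if b then side i else - side i
  end.

Definition jump_prob (m : jump d) : R :=
  match m with
  | inl b => if b then p / d%:R else (1 - p) / d%:R
  | inr _ => (2 * d%:R)^-1
  end.

Lemma big_jump (V : nmodType) (F : jump d -> V) :
  \sum_m F m = F (inl true) + F (inl false) +
               \sum_(i < d.-1) (F (inr (i, true)) + F (inr (i, false))).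
Proof.
rewrite big_sumType /= big_bool; congr (_ + _).
rewrite (eq_bigr (fun q => F (inr (q.1, q.2)))) => [|[] //].
rewrite -(pair_bigA _ (fun i b => F (inr (i, b)))) /=.
by apply: eq_bigr => i _; rewrite big_bool.
Qed.

Lemma stepE (z w : site) :
  step p z w = \sum_m jump_prob m * (w == z + displacement m)%:R.
Proof.
rewrite big_jump /step /=; congr (_ + _).
by apply: eq_bigr => i _; rewrite -mulrDr.
Qed.

Lemma adjP (z w : site) :
  reflect (exists m, w = z + displacement m) (adj z w).
Proof.
apply: (iffP idP) => [|[[[]|[i []]] ->]]; last 4 first.
- by rewrite /adj eqxx.
- by rewrite /adj eqxx orbT.
- by apply/or3P/Or33/existsP; exists i; rewrite eqxx.
- by apply/or3P/Or33/existsP; exists i; rewrite eqxx orbT.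
case/or3P => [/eqP->|/eqP->|/existsP[i /orP[]/eqP->]].
- by exists (inl true).
- by exists (inl false).
- by exists (inr (i, true)).
- by exists (inr (i, false)).
Qed.

Lemma levelD (z w : site) : level (z + w) = level z + level w.
Proof. by []. Qed.

Lemma adj_level (z w : site) : adj z w ->
  level w <= level z + 1 /\ level z <= level w + 1.
Proof.
case/adjP => m ->; rewrite levelD.
by case: m => [[]|[i []]]; rewrite /level /=; lia.
Qed.

Lemma adj_sym : symmetric (@adj d L).
Proof.
suff H (z w : site) : adj z w -> adj w z by move=> ? ?; apply/idP/idP; exact: H.
case/adjP => m ->; apply/adjP.
have [m' E] : exists m', displacement m' = - displacement m.
  case: m => [[]|[i []]].
  - by exists (inl false).
  - by exists (inl true); rewrite /= opprK.
  - by exists (inr (i, false)).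
  - by exists (inr (i, true)); rewrite /= opprK.
by exists m'; rewrite E addrK.
Qed.

Lemma adj_shift (a z w : site) : adj (z + a) (w + a) = adj z w.
Proof.
apply/adjP/adjP => -[m E]; exists m; last by rewrite E addrAC.
by apply: (addIr a); rewrite E addrAC.
Qed.

Lemma step_shift (a z w : site) : step p (z + a) (w + a) = step p z w.
Proof.
rewrite !stepE; apply: eq_bigr => m _; congr (_ * _%:R).
by rewrite addrAC (inj_eq (addIr a)).
Qed.

Hypothesis (hd : (1 <= d)%N) (hp : 1 / 2 < p < 1).

Let d_gt0 : 0 < d%:R :> R. Proof. by rewrite ltr0n. Qed.

(** At most each of the jump probabilities, as [1 - p <= p] and [1 - p <= 1]; its
    powers bound the weights of paths from below. *)
Definition ellipticity : R := (1 - p) / (2 * d%:R).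

Lemma ellipticity_gt0 : 0 < ellipticity.
Proof.
case/andP: hp => _ p1.
by rewrite /ellipticity divr_gt0 ?subr_gt0 // mulr_gt0.
Qed.

Lemma jump_prob_ge m : ellipticity <= jump_prob m.
Proof.
case/andP: hp => p0 p1; have d0 := d_gt0.
have E : (2 * d%:R : R)^-1 = d%:R^-1 / 2 by rewrite invfM mulrC.
have i0 : 0 < (d%:R : R)^-1 by rewrite invr_gt0.
rewrite /ellipticity E; set i := d%:R^-1 in i0 *.
by case: m => [[]|j] /=; rewrite -/i ?E -/i; nra.
Qed.

Lemma jump_prob_gt0 m : 0 < jump_prob m.
Proof. exact: lt_le_trans ellipticity_gt0 (jump_prob_ge m). Qed.

Lemma step_ge0 (z w : site) : 0 <= step p z w.
Proof.
rewrite stepE; apply: sumr_ge0 => m _.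
by rewrite mulr_ge0 ?ler0n // ltW ?jump_prob_gt0.
Qed.

Lemma step_ge_jump (z : site) m : jump_prob m <= step p z (z + displacement m).
Proof.
rewrite stepE (bigD1 m) //= eqxx mulr1 lerDl; apply: sumr_ge0 => i _.
by rewrite mulr_ge0 ?ler0n // ltW ?jump_prob_gt0.
Qed.

Lemma step_ge_ellipticity (z w : site) : adj z w -> ellipticity <= step p z w.
Proof.
by case/adjP => m ->; apply: le_trans (step_ge_jump z m); exact: jump_prob_ge.
Qed.

Lemma jump_prob_sum1 : \sum_m jump_prob m = 1.
Proof.
rewrite big_jump /= sumr_const card_ord -(mulr_natl _ d.-1).
have d0 := d_gt0.
have -> : d.-1%:R = d%:R - 1 :> R.
  by rewrite -[in RHS](prednK hd) -addn1 natrD addrK.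
by field; rewrite gt_eqF.
Qed.

(** The factor by which [(2 p) ^ (- |S_t|)] shrinks on average at each step. It is
    [1 - 2 (p - 1/2) ^ 2 / d]; any base strictly between [1] and [p / (1 - p)]
    would give a factor below [1]. *)
Definition tilt_rate : R :=
  \sum_m jump_prob m * (2 * p) ^ (- level (displacement m)).

Lemma tilt_rate_lt1 : tilt_rate < 1.
Proof.
case/andP: hp => p0 p1; have d0 := d_gt0.
rewrite /tilt_rate big_jump /= /level /=.
under eq_bigr do rewrite /= oppr0 expr0z !mulr1.
rewrite sumr_const card_ord -(mulr_natl _ d.-1).
have -> : d.-1%:R = d%:R - 1 :> R.
  by rewrite -[in RHS](prednK hd) -addn1 natrD addrK.
rewrite opprK expr1z exprN1.
have pn0 : p != 0 by rewrite gt_eqF //; lra.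
rewrite -subr_gt0.
have -> : 1 - (p / d%:R / (2 * p) + (1 - p) / d%:R * (2 * p)
   + (d%:R - 1) * ((2 * d%:R)^-1 + (2 * d%:R)^-1)) = 2 * (p - 1 / 2) ^+ 2 / d%:R.
  by field; rewrite pn0 gt_eqF.
by rewrite divr_gt0 // mulr_gt0 // exprn_gt0 //; lra.
Qed.

Lemma tilt_rate_gt0 : 0 < tilt_rate.
Proof.
case/andP: hp => p0 p1.
rewrite /tilt_rate (bigD1 (inl true)) //= ltr_pwDl //.
  by rewrite mulr_gt0 ?exprz_gt0 ?(jump_prob_gt0 (inl true)) //; lra.
apply: sumr_ge0 => i _.
by rewrite mulr_ge0 ?exprz_ge0 // ?ltW ?jump_prob_gt0 //; lra.
Qed.

End Jumps.

(** * First-passage paths and their weights *)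

Section Paths.
Variables (d L : nat).
Local Notation site := (site d L).
Implicit Types (x y z a : site) (s : seq site) (r n : int).

(** The possible trajectories of the walk from [x] up to its first visit to level
    [r], without the starting point. *)
Definition first_passage r x s : bool :=
  [&& path (@adj d L) x s, level (last x s) == r
    & all (fun z => level z != r) (belast x s)].

Lemma first_passage_nil r x : first_passage r x [::] = (level x == r).
Proof. by rewrite /first_passage /= andbT. Qed.

Lemma first_passage_cons r x y s :
  first_passage r x (y :: s) = [&& level x != r, adj x y & first_passage r y s].
Proof.
rewrite /first_passage /=.
by case: (level x != r); rewrite /= ?andbF //= -andbA.
Qed.

Lemma first_passage_last r x s : first_passage r x s -> level (last x s) = r.
Proof. by case/and3P => _ /eqP. Qed.

Lemma first_passage_path r x s : first_passage r x s -> path (@adj d L) x s.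
Proof. by case/and3P. Qed.

Lemma first_passage_below r x s : level x <= r -> first_passage r x s ->
  all (fun z => level z < r) (belast x s).
Proof.
elim: s x => //= y s IH x xr; rewrite first_passage_cons => /and3P[xnr xy ys].
have xr' : level x < r by rewrite lt_neqAle xnr.
by rewrite xr' IH //; have [] := adj_level xy; lia.
Qed.

Lemma first_passage_le r x s z : level x <= r -> first_passage r x s ->
  z \in x :: s -> level z <= r.
Proof.
move=> xr xs; rewrite lastI mem_rcons inE => /orP[/eqP->|].
  by rewrite (first_passage_last xs).
by move/(allP (first_passage_below xr xs))/ltW.
Qed.

(** Levels change by at most one at a step, so none is jumped over. *)
Lemma path_first_passage r x s : path (@adj d L) x s -> level x <= r ->
  r <= level (last x s) ->
  exists s1 s2, s = s1 ++ s2 /\ first_passage r x s1.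
Proof.
elim: s x => [|y s IH] x /=.
  move=> _ xr rx; exists [::], [::].
  by rewrite first_passage_nil eq_le xr rx.
case/andP => xy ys xr rs; have [xr'|xnr] := eqVneq (level x) r.
  by exists [::], (y :: s); rewrite first_passage_nil xr' eqxx.
have yr : level y <= r.
  have [] := adj_level xy; move/eqP in xnr; lia.
have [s1 [s2 [-> s1P]]] := IH y ys yr rs.
by exists (y :: s1), s2; rewrite first_passage_cons xnr xy.
Qed.

Lemma first_passage_cat r n x s1 s2 : level x <= r -> r <= n ->
  first_passage r x s1 -> first_passage n (last x s1) s2 ->
  first_passage n x (s1 ++ s2).
Proof.
move=> xr rn; elim: s1 x xr => [//|y s1 IH] x xr /=.
rewrite !first_passage_cons => /and3P[xnr xy ys] s2P.
rewrite xy IH //; last by have [] := adj_level xy; move/eqP in xnr; lia.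
by rewrite lt_eqF //; move/eqP in xnr; lia.
Qed.

Lemma first_passage_split r n x s : level x <= r -> r <= n ->
  first_passage n x s -> exists s1 s2,
    [/\ s = s1 ++ s2, first_passage r x s1 & first_passage n (last x s1) s2].
Proof.
move=> xr rn /and3P[xs /eqP ls na].
have [|s1 [s2 [E s1P]]] := path_first_passage xs xr; first by rewrite ls.
exists s1, s2; split=> //; move: xs ls na; rewrite E.
rewrite cat_path last_cat belast_cat all_cat => /andP[_ p2] ls /andP[_ a2].
by rewrite /first_passage p2 ls eqxx.
Qed.

(** No proper prefix of a first-passage path is one, so a concatenation
    determines its first piece. *)
Lemma first_passage_cat_inj r x s1 s2 s1' s2' :
  first_passage r x s1 -> first_passage r x s1' ->
  s1 ++ s2 = s1' ++ s2' -> s1 = s1' /\ s2 = s2'.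
Proof.
elim: s1 x s1' => [|y s1 IH] x [|y' s1'] //=.
- by rewrite first_passage_nil first_passage_cons => ->.
- by rewrite first_passage_nil first_passage_cons => /and3P[/negP].
- rewrite !first_passage_cons => /and3P[_ _ a] /and3P[_ _ b] [yy E].
  by subst y'; have [-> ->] := IH _ _ a b E.
Qed.

Lemma first_passage_shift a r x s :
  first_passage (r + level a) (x + a) (map (+%R^~ a) s) = first_passage r x s.
Proof.
elim: s x => [|y s IH] x /=.
  by rewrite !first_passage_nil levelD (inj_eq (addIr _)).
by rewrite !first_passage_cons levelD (inj_eq (addIr _)) adj_shift IH.
Qed.

Lemma path_levels x s z : path (@adj d L) x s -> z \in x :: s ->
  level x - (size s)%:Z <= level z.
Proof.
elim: s x => [|y s IH] x /=; first by rewrite inE => _ /eqP ->; lia.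
case/andP => xy ys; rewrite inE => /orP[/eqP ->|zs]; first by lia.
by have := IH y ys zs; have [] := adj_level xy; lia.
Qed.

End Paths.

Section Weights.
Variables (R : realType) (d L : nat) (p : R).
Local Notation site := (site d L).
Implicit Types (x y z a : site) (s : seq site) (r n : int).

(** The probability that the walk started at [x] begins with the sites [s]. *)
Fixpoint weight x s : R :=
  if s is y :: s' then step p x y * weight y s' else 1.

Lemma weight_cat x s1 s2 :
  weight x (s1 ++ s2) = weight x s1 * weight (last x s1) s2.
Proof. by elim: s1 x => [|y s1 IH] x /=; rewrite ?mul1r // IH mulrA. Qed.

Lemma weight_shift a x s : weight (x + a) (map (+%R^~ a) s) = weight x s.
Proof. by elim: s x => //= y s IH x; rewrite step_shift IH. Qed.

Lemma weightE x s :
  \prod_(t < size s) step p (nth x (x :: s) t) (nth x (x :: s) t.+1)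
  = weight x s.
Proof.
rewrite /=; elim: s x => [|y s IH] x; first by rewrite big_ord0.
rewrite big_ord_recl /=; congr (_ * _); rewrite -IH; apply: eq_bigr => i _ /=.
have ->: nth x (y :: s) i = nth y (y :: s) i.
  by apply: set_nth_default; rewrite ltnS ltnW.
by rewrite add0n (set_nth_default y x).
Qed.

Hypothesis (hd : (1 <= d)%N) (hp : 1 / 2 < p < 1).

Lemma weight_ge0 x s : 0 <= weight x s.
Proof.
by elim: s x => [|y s IH] x //=; rewrite mulr_ge0 ?(step_ge0 hd hp).
Qed.

Lemma weight_ge_ellipticity x s : path (@adj d L) x s ->
  ellipticity d p ^+ size s <= weight x s.
Proof.
elim: s x => [|y s IH] x //= /andP[xy ys]; rewrite exprS.
by rewrite ler_pM ?exprn_ge0 ?IH ?(ltW (ellipticity_gt0 hd hp))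
   ?(step_ge_ellipticity hd hp).
Qed.

Lemma weight_gt0 x s : path (@adj d L) x s -> 0 < weight x s.
Proof.
move=> xs; apply: lt_le_trans (weight_ge_ellipticity xs).
by rewrite exprn_gt0 // (ellipticity_gt0 hd hp).
Qed.

End Weights.

(** * Sums over countable types *)

Section Esum.
Variable R : realType.
Local Open Scope ereal_scope.

Lemma esum_subset (T : choiceType) (I J : set T) (a : T -> \bar R) :
  I `<=` J -> \esum_(i in I) a i <= \esum_(i in J) a i.
Proof.
move=> IJ; apply: ereal_sup_le => _ [X [finX XI] <-]; exists X => //.
by split=> //; apply: subset_trans IJ.
Qed.

Lemma esum_ge_term (T : choiceType) (I : set T) (a : T -> \bar R) (t : T) :
  I t -> 0 <= a t -> a t <= \esum_(i in I) a i.
Proof. by move=> It a0; rewrite -esum_set1 //; apply: esum_subset => _ ->. Qed.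

Lemma le_esum_inj (T T' : choiceType) (P : set T) (Q : set T') (e : T -> T')
    (a : T' -> \bar R) :
  (forall i, P i -> Q (e i)) -> set_inj P e ->
  \esum_(i in P) a (e i) <= \esum_(j in Q) a j.
Proof.
move=> PQ inj; rewrite -esum_image //; apply: esum_subset => _ [i Pi <-].
exact: PQ.
Qed.

Lemma esumZl (T : choiceType) (I : set T) (a : T -> \bar R) (c : R) :
  (0 <= c)%R -> (forall i, 0 <= a i) ->
  \esum_(i in I) (c%:E * a i) = c%:E * \esum_(i in I) a i.
Proof.
move=> c0 a0; rewrite /esum -ereal_supZl //; last first.
  by apply/set0P; exists (\sum_(x \in set0) a x); exists set0 => //; exact: fsets_set0.
congr ereal_sup.
apply/seteqP; split => [_ [X XI <-]|_ [_ [X XI <-] <-]] /=.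
  exists (\sum_(x \in X) a x); first by exists X.
  by rewrite ge0_mule_fsumr.
by exists X => //; rewrite ge0_mule_fsumr.
Qed.

Lemma measurable_bigcup_countType (disp : measure_display)
    (Om : measurableType disp) (C : countType) (D : set C) (F : C -> set Om) :
  (forall c, D c -> measurable (F c)) -> measurable (\bigcup_(c in D) F c).
Proof.
move=> mF; pose G n := if unpickle n is Some c then F c else set0.
have -> : \bigcup_(c in D) F c = \bigcup_(n in @pickle C @` D) G n.
  by rewrite bigcup_image; apply: eq_bigcupr => c _; rewrite /G pickleK.
by apply: bigcup_measurable => _ [c Dc <-]; rewrite /G pickleK; exact: mF.
Qed.

(** Countable additivity in the form that suits events indexed by paths. *)
Lemma measure_bigcup_esum (disp : measure_display) (Om : measurableType disp)
    (mu : probability Om R) (C : countType) (D : set C)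
    (F : C -> set Om) :
  (forall c, D c -> measurable (F c)) -> trivIset D F ->
  mu (\bigcup_(c in D) F c) = \esum_(c in D) mu (F c).
Proof.
move=> mF tF.
pose G n := if unpickle n is Some c then F c else set0.
have GE c : G (pickle c) = F c by rewrite /G pickleK.
have inj : set_inj D (@pickle C) by move=> ? ? _ _; exact: (pcan_inj pickleK).
transitivity (mu (\bigcup_(n in pickle @` D) G n)).
  by rewrite bigcup_image; congr (mu _); apply: eq_bigcupr => c _; rewrite GE.
rewrite measure_bigcup; last 2 first.
- by move=> _ [c Dc <-]; rewrite GE; exact: mF.
- move=> _ _ [c Dc <-] [c' Dc' <-]; rewrite !GE => H.
  by congr pickle; exact: tF.
rewrite nneseries_esum // set_mem_set esum_image //.
by apply: eq_esum => c _; rewrite GE.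
Qed.

End Esum.

(** * Almost sure passage to higher levels *)

Section Mass.
Variables (R : realType) (d L : nat) (p : R).
Local Notation site := (site d L).
Implicit Types (x y z a : site) (s : seq site) (r n : int).
Hypothesis (hd : (1 <= d)%N) (hp : 1 / 2 < p < 1).
Local Open Scope ereal_scope.

Lemma esum_step z (f : site -> \bar R) : (forall y, 0 <= f y) ->
  \esum_(y in [set: site]) ((step p z y)%:E * f y)
  = \sum_m (jump_prob p m)%:E * f (z + displacement L m)%R.
Proof.
move=> f0; have wt0 (m : jump d) : (0 <= jump_prob p m)%R.
  exact: ltW (jump_prob_gt0 hd hp m).
transitivity (\esum_(y in [set: site]) \sum_m
    ((jump_prob p m * (y == z + displacement L m)%:R)%:E * f y)).
  apply: eq_esum => y _; rewrite stepE -sumEFin ge0_sume_distrl // => m _.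
  by rewrite lee_fin mulr_ge0 ?ler0n.
rewrite esum_sum => [|y m _ _]; last first.
  by rewrite mule_ge0 // lee_fin mulr_ge0 ?ler0n.
apply: eq_bigr => m _; set a := (z + _)%R.
rewrite -(@esum_set1 _ _ a (fun y => (jump_prob p m)%:E * f y)) ?mule_ge0 ?lee_fin //.
rewrite [RHS]esum_mkcond; apply: eq_esum => y _.
have [->|ya] := eqVneq y a; first by rewrite mem_set // mulr1.
by rewrite memNset ?mulr0 ?mul0e // => /eqP; rewrite (negbTE ya).
Qed.

Definition passage_mass r x : \bar R :=
  \esum_(s in [set s | first_passage r x s]) (weight p x s)%:E.

Lemma passage_mass_ge0 r x : 0 <= passage_mass r x.
Proof. by apply: esum_ge0 => s _; rewrite lee_fin (weight_ge0 hd hp). Qed.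

(** Condition on the first step. *)
Lemma passage_mass_superharmonic r x : level x != r ->
  \sum_m (jump_prob p m)%:E * passage_mass r (x + displacement L m)%R
  <= passage_mass r x.
Proof.
move=> xr.
pose f y := \esum_(s in [set s | adj x y && first_passage r y s])
              (weight p y s)%:E.
have f0 y : 0 <= f y by apply: esum_ge0 => s _; rewrite lee_fin (weight_ge0 hd hp).
have -> : \sum_m (jump_prob p m)%:E * passage_mass r (x + displacement L m)%R
        = \esum_(y in [set: site]) ((step p x y)%:E * f y).
  rewrite esum_step //; apply: eq_bigr => m _; congr (_ * _).
  rewrite /f /passage_mass; congr esum; apply/seteqP; split => s /=.
    by move=> ->; rewrite andbT; apply/adjP; exists m.
  by case/andP.
have -> : \esum_(y in [set: site]) ((step p x y)%:E * f y) =
    \esum_(y in [set: site]) \esum_(s in [set s | adj x y && first_passage r y s])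
      ((step p x y)%:E * (weight p y s)%:E).
  apply: eq_esum => y _; rewrite esumZl ?(step_ge0 hd hp) // => s.
  by rewrite lee_fin (weight_ge0 hd hp).
rewrite esum_esum; last first.
  move=> y s _ _.
  by rewrite -EFinM lee_fin mulr_ge0 ?(step_ge0 hd hp) ?(weight_ge0 hd hp).
apply: (@le_esum_inj _ _ _ _ _ (fun q : site * seq site => q.1 :: q.2)
          (fun s => (weight p x s)%:E)) => [[y s] /= [_ /andP[xy ys]]|].
  by rewrite first_passage_cons xr xy.
by move=> [y s] [y' s'] _ _ /= [-> ->].
Qed.

(** On average [(2 p) ^ (- |S_t|)] shrinks by the factor [tilt_rate] at each step,
    and so does the bound on the defect of the mass. *)
Lemma passage_mass_ge (t : nat) r x : (level x <= r)%R ->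
  (1 - tilt_rate d L p ^+ t * (2 * p) ^ (r - level x))%:E <= passage_mass r x.
Proof.
have p0 : (1 < 2 * p)%R by case/andP: hp => ? _; lra.
have [tp b0] : (0 < 2 * p)%R /\ (0 < tilt_rate d L p)%R.
  by split; [exact: lt_trans p0|exact: tilt_rate_gt0 hd hp].
have base x' : level x' = r -> 1 <= passage_mass r x'.
  move=> xr; have <- : \esum_(s in [set [::]]) (weight p x' s)%:E = 1.
    by rewrite esum_set1 //= lee_fin.
  by apply: esum_subset => _ ->; rewrite /= first_passage_nil xr.
elim: t x => [|t IH] x xr.
  have [xe|xr'] := eqVneq (level x) r.
    by apply: le_trans (base _ xe); rewrite xe subrr expr0z lee_fin; lra.
  apply: le_trans (passage_mass_ge0 _ _); rewrite lee_fin expr0 mul1r subr_le0.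
  have -> : (r - level x)%R = `|(r - level x)%R|%N by lia.
  by rewrite -exprnP exprn_ege1 // ltW.
have [xe|xr'] := eqVneq (level x) r.
  apply: le_trans (base _ xe); rewrite xe subrr expr0z lee_fin.
  by rewrite gerBl mulr1 exprn_ge0 // ltW.
apply: le_trans (passage_mass_superharmonic xr').
have E : (1 - tilt_rate d L p ^+ t.+1 * (2 * p) ^ (r - level x) =
   \sum_m jump_prob p m * (1 - tilt_rate d L p ^+ t *
      (2 * p) ^ (r - level (x + displacement L m))))%R.
  under eq_bigr do rewrite mulrBr mulr1.
  rewrite sumrB (jump_prob_sum1 p hd); congr (_ - _)%R.
  rewrite exprS -mulrA /tilt_rate mulr_suml; apply: eq_bigr => m _.
  rewrite levelD opprD addrA [in RHS]expfzDr ?gt_eqF //.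
  by rewrite mulrA -mulrA -!mulrA; congr (_ * _)%R; rewrite mulrCA; congr (_ * _)%R; rewrite mulrC.
rewrite E -sumEFin; apply: lee_sum => m _.
rewrite EFinM lee_pmul2l ?lte_fin ?(jump_prob_gt0 hd hp) // IH //.
have : adj x (x + displacement L m)%R by apply/adjP; exists m.
by case/adj_level; move/eqP in xr'; lia.
Qed.

(** The walk drifts upwards, so it reaches every higher level. *)
Lemma passage_mass_ge1 r x : (level x <= r)%R -> 1 <= passage_mass r x.
Proof.
move=> xr; apply/lee_addgt0Pr => e e0.
have [t te] : exists t, (tilt_rate d L p ^+ t * (2 * p) ^ (r - level x) < e)%R.
  have : (tilt_rate d L p ^+ t * (2 * p) ^ (r - level x) @[t --> \oo] --> (0 : R))%R.
    rewrite -[X in _ --> X](mul0r ((2 * p) ^ (r - level x))).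
    apply: cvgMl; apply: cvg_expr.
    by rewrite ger0_norm ?(tilt_rate_lt1 _ hd hp) // ltW // (tilt_rate_gt0 _ hd hp).
  move/cvgr_lt => /(_ e e0) [N _ HN]; exists N; apply: (HN N); exact: leqnn.
apply: le_trans (_ : (1 - tilt_rate d L p ^+ t * (2 * p) ^ (r - level x))%:E + e%:E <= _).
  by rewrite -EFinD lee_fin; lra.
by rewrite leeD2r // passage_mass_ge.
Qed.

End Mass.

(** * Trajectories and first-passage paths *)

Section Follows.
Variables (d L : nat).
Local Notation site := (site d L).
Implicit Types (x y z a : site) (s : seq site) (r n : int) (g : nat -> site).

Definition follows g x s : Prop :=
  forall t, (t <= size s)%N -> g t = nth x (x :: s) t.

Lemma follows_cons g x y s :
  follows g x (y :: s) <-> g 0%N = x /\ follows (fun t => g t.+1) y s.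
Proof.
split=> [H|[g0 H]].
  split; first exact: (H 0%N).
  by move=> t ts; rewrite (H t.+1) //; apply: set_nth_default.
by move=> [|t] ts; [exact: g0|rewrite H //; apply: set_nth_default].
Qed.

Lemma follows_last g x s : follows g x s -> g (size s) = last x s.
Proof. by move=> H; rewrite H // nth_last. Qed.

(** Both paths stop at the first time when the trajectory is on level [r]. *)
Lemma follows_inj r g x s s' : first_passage r x s -> first_passage r x s' ->
  follows g x s -> follows g x s' -> s = s'.
Proof.
elim: s x s' g => [|y s IH] x [|y' s'] g //.
- by rewrite first_passage_nil first_passage_cons => ->.
- by rewrite first_passage_nil first_passage_cons => /and3P[/negP].
rewrite !first_passage_cons => /and3P[_ _ a] /and3P[_ _ b].
move=> /follows_cons[_ H] /follows_cons[_ H'].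
have E : y = y' := etrans (esym (H 0%N isT)) (H' 0%N isT).
by subst y'; rewrite (IH _ _ _ a b H H').
Qed.

Lemma visited_level r g : level (g 0%N) = r -> visited r g = [set g 0%N].
Proof.
move=> g0; apply/seteqP; split=> [_ [[|t] Ht <-] //|_ ->]; last by exists 0%N.
by case: (Ht 0%N).
Qed.

Lemma visited_rec r g : level (g 0%N) != r ->
  visited r g = g 0%N |` visited r (fun t => g t.+1).
Proof.
move=> /eqP g0; apply/seteqP; split=> [_ [[|t] Ht <-]|z [->|[t Ht <-]]].
- by left.
- by right; exists t => // u ut; apply: Ht.
- by exists 0%N.
- by exists t.+1 => // -[|u] // ut; apply: Ht.
Qed.

Lemma visited_follows r g x s : first_passage r x s -> follows g x s ->
  visited r g = [set` x :: s].
Proof.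
elim: s x g => [|y s IH] x g.
  rewrite first_passage_nil => /eqP xr /(_ 0%N isT) /= gx.
  rewrite visited_level ?gx //; apply/seteqP; split=> z /=.
    by move=> ->; rewrite inE.
  by rewrite inE => /eqP.
rewrite first_passage_cons => /and3P[xr xy ys] /follows_cons[g0 H].
rewrite visited_rec ?g0 // (IH _ _ ys H); apply/seteqP; split=> z /=.
  by case=> [->|zs]; rewrite inE ?eqxx // zs orbT.
by rewrite inE => /orP[/eqP|]; [left|right].
Qed.

(** Extensions of configurations are made of infinite trajectories; a finite path
    becomes one by going straight up from its last site. *)
Fixpoint prolong x s (t : nat) : site :=
  match t, s with
  | 0%N, _ => x
  | t'.+1, [::] => prolong (x + up d L) [::] t'
  | t'.+1, y :: s' => prolong y s' t'
  end.

Lemma follows_prolong x s : follows (prolong x s) x s.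
Proof.
elim: s x => [|y s IH] x; first by rewrite /follows; case.
by apply/follows_cons; split => //; exact: IH.
Qed.

Lemma prolong_adj x s t : path (@adj d L) x s ->
  adj (prolong x s t) (prolong x s t.+1).
Proof.
elim: t x s => [|t IH] x [|y s] //=.
- by move=> _; apply/adjP; exists (inl true).
- by case/andP.
- by move=> _; exact: (IH _ [::]).
- by case/andP => _ /IH.
Qed.

End Follows.

Lemma measure_setI_full (R : realType) (disp : measure_display)
    (Om : measurableType disp) (P : probability Om R) (A U : set Om) :
  measurable A -> measurable U -> P U = 1%E -> P (A `&` U) = P A.
Proof.
move=> mA mU U1.
have nU : P (~` U) = 0%E by rewrite probability_setC // U1 subee.
have nD : P (A `\` U) = 0%E.
  apply: (subset_measure0 _ _ _ nU); first exact: measurableD.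
    exact: measurableC.
  exact: subIsetr.
have -> : P A = (P (A `\` U) + P (A `&` U))%E by exact: measureDI.
by rewrite nD add0e.
Qed.

Section WalkEvents.
Variables (R : realType) (d L : nat) (p : R).
Local Notation site := (site d L).
Implicit Types (x y z a : site) (s : seq site) (r n : int).
Hypothesis (hd : (1 <= d)%N) (hp : 1 / 2 < p < 1).
Variables (disp : measure_display) (Om : measurableType disp)
  (P : probability Om R) (S : nat -> Om -> site) (x : site).
Hypothesis HS : random_walk p P S x.

Lemma walk_measurable t (A : set site) : measurable [set w | A (S t w)].
Proof.
case: HS => mS _.
have -> : [set w | A (S t w)] = \bigcup_(z in A) [set w | S t w = z].
  apply/seteqP; split=> w; first by move=> Aw; exists (S t w).
  by case=> z Az /= ->.
by apply: measurable_bigcup_countType => z _; exact: mS.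
Qed.

Definition follows_event s : set Om := [set w | follows (S ^~ w) x s].

Lemma follows_eventE s :
  follows_event s = [set w | forall t, (t <= size s)%N -> S t w = nth x (x :: s) t].
Proof. by []. Qed.

Lemma follows_event_measurable s : measurable (follows_event s).
Proof.
have -> : follows_event s = \bigcap_(t in [set t | (t <= size s)%N])
    [set w | [set nth x (x :: s) t] (S t w)].
  by apply/seteqP; split=> w H t /= ts; exact: H.
by apply: bigcap_measurable => [|t _]; [exists 0%N|exact: walk_measurable].
Qed.

Lemma follows_event_prob s : P (follows_event s) = (weight p x s)%:E.
Proof. by rewrite follows_eventE HS.2 /= eqxx mul1r -weightE. Qed.

Lemma follows_event_trivIset r :
  trivIset [set s | first_passage r x s] follows_event.
Proof.
by move=> s s' /= a b [w [/= H H']]; exact: follows_inj a b H H'.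
Qed.

Lemma first_passage_prob r : P (\bigcup_(s in [set s | first_passage r x s])
  follows_event s) = passage_mass p r x.
Proof.
rewrite measure_bigcup_esum; last exact: follows_event_trivIset.
  by apply: eq_esum => s _; rewrite follows_event_prob.
by move=> s _; exact: follows_event_measurable.
Qed.

Lemma first_passage_as r : level x <= r ->
  P (\bigcup_(s in [set s | first_passage r x s]) follows_event s) = 1%E.
Proof.
move=> xr; apply/eqP; rewrite eq_le probability_le1 /=; last first.
  by apply: measurable_bigcup_countType => s _; exact: follows_event_measurable.
by rewrite first_passage_prob (passage_mass_ge1 hd hp).
Qed.

Lemma avoids_measurable r (A : set site) : measurable (avoids S r A).
Proof.
have -> : avoids S r A = \bigcap_t
    (\bigcup_(u in [set u | (u < t)%N]) [set w | [set z | level z = r] (S u w)]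
     `|` [set w | (~` A) (S t w)]).
  apply/seteqP; split=> w /=.
    move=> H t _; have [Ht|Ht] := pselect (forall u, (u < t)%N -> level (S u w) <> r).
      right=> At; suff : (visited r (S ^~ w) `&` A) (S t w) by rewrite H.
      by split=> //; exists t.
    by left; move/existsNP : Ht => [u /not_implyP[ut /contrapT Hu]]; exists u.
  move=> H; apply/seteqP; split=> // _ [[t Ht <-] At].
  by case: (H t I) => [[u ut]|//] /=; exact: Ht.
apply: bigcap_measurable => [|t _]; first by exists 0%N.
apply: measurableU; last exact: walk_measurable.
by apply: bigcup_measurable => u _; exact: walk_measurable.
Qed.

(** Up to a null set the walk reaches level [r], and then the event depends on the
    path that it has followed. *)
Lemma avoids_prob r (A : set site) : level x <= r ->
  P (avoids S r A) = (\esum_(s in [set s | first_passage r x s /\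
                        forall z, z \in x :: s -> ~ A z]) (weight p x s)%:E)%E.
Proof.
move=> xr; set U := \bigcup_(s in [set s | first_passage r x s]) follows_event s.
have mU : measurable U.
  by apply: measurable_bigcup_countType => s _; exact: follows_event_measurable.
have mA := avoids_measurable r A.
rewrite -(measure_setI_full mA mU (first_passage_as xr)).
rewrite (eq_esum (fun s _ => esym (follows_event_prob s))).
rewrite -measure_bigcup_esum; last 2 first.
- by move=> s _; exact: follows_event_measurable.
- by move=> s s' [a _] [b _] H; exact: (follows_event_trivIset a b H).
congr (P _); apply/seteqP; split=> w.
  move=> [Hav [s /= rs fs]]; exists s => //=; split=> // z zs Az.
  suff : (visited r (S ^~ w) `&` A) z by rewrite Hav.
  by split=> //; rewrite (visited_follows rs fs).
case=> s [/= rs H] fs; split; last by exists s.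
apply/seteqP; split=> // z; rewrite (visited_follows rs fs) => -[/= zs].
exact: H.
Qed.

End WalkEvents.

(** * Independent walks *)

(** Independence for singletons passes to arbitrary events one coordinate at a
    time, by summing over the values of that coordinate. *)
Lemma independence_countType (R : realType) (disp : measure_display)
    (Om : measurableType disp) (P : probability Om R) (k : nat) (C : countType)
    (X : 'I_k -> Om -> C) :
  (forall i c, measurable [set w | X i w = c]) ->
  (forall g : 'I_k -> C, P [set w | forall i, X i w = g i]
     = (\prod_i fine (P [set w | X i w = g i]))%:E) ->
  forall B : 'I_k -> set C, P [set w | forall i, B i (X i w)]
     = (\prod_i fine (P [set w | B i (X i w)]))%:E.
Proof.
move=> mX ind.
have mXB i (A : set C) : measurable [set w | A (X i w)].
  have -> : [set w | A (X i w)] = \bigcup_(c in A) [set w | X i w = c].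
    by apply/seteqP; split=> w /=; [exists (X i w)|case=> c Ac /= ->].
  exact: measurable_bigcup_countType.
suff main (J : seq 'I_k) (B : 'I_k -> set C) :
    (forall i, i \notin J -> exists c, B i = [set c]) ->
    P [set w | forall i, B i (X i w)]
      = (\prod_i fine (P [set w | B i (X i w)]))%:E.
  by move=> B; apply: (main (enum 'I_k)) => i; rewrite mem_enum.
elim: J B => [|j J IH] B HB.
  have [g Hg] := @boolp.choice _ _ (fun i c => B i = [set c]) (fun i => HB i isT).
  transitivity (P [set w | forall i, X i w = g i]).
    by congr (P _); apply/seteqP; split=> w /= H i; have := H i; rewrite Hg.
  by rewrite ind; congr (_%:E); apply: eq_bigr => i _; rewrite Hg.
pose Bc c i := if i == j then [set c] else B i.
pose F c := [set w | forall i, Bc c i (X i w)].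
have mF c : measurable (F c).
  have -> : F c = \bigcap_(i in [set: 'I_k]) [set w | Bc c i (X i w)].
    by apply/seteqP; split=> w H i; [move=> _; exact: H|exact: H].
  apply: fin_bigcap_measurable => [|i _]; first exact: finite_finset.
  exact: mXB.
rewrite (_ : [set w | forall i, B i (X i w)] = \bigcup_(c in B j) F c); last first.
  apply/seteqP; split=> w /=.
    move=> H; exists (X j w) => // i; rewrite /Bc; case: eqP => [->|_] //.
  case=> c Bc' H i; have := H i; rewrite /Bc; case: eqP => [->|_] //=.
  by move=> ->.
rewrite measure_bigcup_esum //; last first.
  move=> c c' _ _ [w [Hc Hc']]; have := Hc j; have := Hc' j.
  by rewrite /Bc eqxx /= => <-.
have E c : P (F c) = ((\prod_(i | i != j) fine (P [set w | B i (X i w)]))%:E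
                      * P [set w | X j w = c])%E.
  rewrite IH => [|i iJ]; last first.
    rewrite /Bc; case: eqP => [_|/eqP ij]; first by exists c.
    by apply: HB; rewrite inE negb_or ij.
  rewrite (bigD1 j) //= mulrC EFinM; congr (_ * _)%E.
    by congr (_%:E); apply: eq_bigr => i ij; rewrite /Bc (negbTE ij).
  by rewrite /Bc eqxx fineK // fin_num_measure.
rewrite (eq_esum (fun c _ => E c)) esumZl //; last first.
  by apply: prodr_ge0 => i _; exact: fine_ge0.
rewrite -measure_bigcup_esum //; last first.
  by move=> c c' _ _ [w [/= <- <-]].
rewrite [in RHS](bigD1 j) //= mulrC EFinM; congr (_ * _)%E.
rewrite fineK ?fin_num_measure //; congr (P _).
by apply/seteqP; split=> w /=; [case=> c Bjc /= ->|exists (X j w)].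
Qed.

Section JointEvents.
Variables (R : realType) (d L : nat) (p : R) (k : nat).
Local Notation site := (site d L).
Implicit Types (g : {ffun 'I_k -> seq site}).
Hypothesis (hd : (1 <= d)%N) (hp : 1 / 2 < p < 1).
Variables (disp : measure_display) (Om : measurableType disp)
  (P : probability Om R) (W : 'I_k -> nat -> Om -> site) (x : 'I_k -> site).
Hypothesis HW : independent_walks p P W x.

Definition joint_event g : set Om :=
  [set w | forall i, follows (fun t => W i t w) (x i) (g i)].

Definition joint_weight g : R := \prod_i weight p (x i) (g i).

Lemma joint_event_measurable g : measurable (joint_event g).
Proof.
have -> : joint_event g = \bigcap_(i in [set: 'I_k]) follows_event (W i) (x i) (g i).
  by apply/seteqP; split=> w H i; [move=> _; exact: H|exact: H].
apply: fin_bigcap_measurable => [|i _]; first exact: finite_finset.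
exact: (follows_event_measurable (HW.1 i)).
Qed.

(** The paths have different lengths, while independence is known at a common
    time: each path becomes a set of trajectories up to the longest time. *)
Lemma joint_event_prob g : P (joint_event g) = (joint_weight g)%:E.
Proof.
case: HW => rw ind; pose m := \max_i size (g i).
have gm i : (size (g i) <= m)%N by exact: (leq_bigmax i).
pose X i w : {ffun 'I_m.+1 -> site} := [ffun t : 'I_m.+1 => W i t w].
pose B i : set {ffun 'I_m.+1 -> site} := [set f | forall t : 'I_m.+1,
  (t <= size (g i))%N -> f t = nth (x i) (x i :: g i) t].
have BE i w : B i (X i w) <-> follows (fun t => W i t w) (x i) (g i).
  split=> H t tg; last by rewrite ffunE; exact: H.
  have tm : (t < m.+1)%N by rewrite ltnS (leq_trans tg).
  by have := H (Ordinal tm) tg; rewrite ffunE.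
have XE i w (f : {ffun 'I_m.+1 -> site}) :
    X i w = f <-> forall t, (t <= m)%N -> W i t w = f (inord t).
  split=> [<- t tm|H]; first by rewrite ffunE inordK.
  by apply/ffunP => t; rewrite ffunE H ?inord_val // -ltnS.
have -> : joint_event g = [set w | forall i, B i (X i w)].
  by apply/seteqP; split=> w H i; have := H i; rewrite /= BE.
rewrite (@independence_countType _ _ _ P _ _ X).
- congr (_%:E); apply: eq_bigr => i _.
  rewrite (_ : [set w | B i (X i w)] = follows_event (W i) (x i) (g i)).
    by rewrite (follows_event_prob (rw i)).
  by apply/seteqP; split=> w /BE.
- move=> i f; rewrite (_ : [set w | X i w = f] = \bigcap_(t in [set t | (t <= m)%N])
      [set w | [set f (inord t)] (W i t w)]).
    apply: bigcap_measurable => [|t _]; first by exists 0%N.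
    exact: (walk_measurable (rw i)).
  by apply/seteqP; split=> w /= H; [move=> t tm; exact: ((XE i w f).1 H)|exact/XE].
- move=> f; rewrite (_ : [set w | forall i, X i w = f i] =
    [set w | forall i t, (t <= m)%N -> W i t w = f i (inord t)]); last first.
    by apply/seteqP; split=> w /= H i; [exact: ((XE i w (f i)).1 (H i))|apply/XE; exact: H].
  rewrite (ind m (fun i t => f i (inord t))); congr (_%:E); apply: eq_bigr => i _.
  by congr (fine (P _)); apply/seteqP; split=> w /=; [move/XE|move=> H; exact/XE].
Qed.

End JointEvents.

(** * Expectations as sums over tuples of paths *)

Section Integral.
Variables (R : realType) (disp : measure_display) (Om : measurableType disp)
  (P : probability Om R).
Local Open Scope ereal_scope.
Import HBNNSimple.

(** For a nonnegative integrand the integral is the supremum of the integrals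
    of the simple functions below it, and cutting a simple function off on a
    null set does not change its integral. This covers integrands that may fail
    to be measurable where a walk never reaches its level. *)
Lemma integral_full_set (U : set Om) (f : Om -> \bar R) :
  measurable U -> P (~` U) = 0 -> (forall w, 0 <= f w) ->
  \int[P]_w f w = \int[P]_(w in U) f w.
Proof.
move=> mU U0 f0; rewrite [RHS]integral_mkcond.
have fU0 w : 0 <= (f \_ U) w by rewrite /patch; case: ifP.
rewrite (ge0_integralTE _ f0) (ge0_integralTE _ fU0); apply/eqP; rewrite eq_le; apply/andP; split.
  apply: ge_ereal_sup => _ [h hf <-]; apply: ereal_sup_ubound.
  exists (proj_nnsfun h mU).
    move=> w; rewrite -mrestrict /patch; case: ifP => // _; exact: hf.
  rewrite -mrestrict -integral_nnsfun // -integralT_nnsfun.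
  rewrite [in RHS](@ge0_negligible_integral _ _ _ P setT (~` U)) //.
  - by rewrite setTD setCK.
  - exact: measurableC.
  - by apply/measurable_EFinP.
  - by move=> w _; rewrite lee_fin fun_ge0.
apply: ge_ereal_sup => _ [h hf <-]; apply: ereal_sup_ubound; exists h => // w.
by apply: le_trans (hf w) _; rewrite /patch; case: ifP.
Qed.

(** The integrand is constant on each of countably many events, which exhaust the
    space up to a null set where nothing is known about it. *)
Lemma integral_countable_partition (C : countType) (D : set C)
    (E : C -> set Om) (f : Om -> \bar R) (v : C -> \bar R) :
  (forall c, measurable (E c)) -> trivIset D E ->
  P (\bigcup_(c in D) E c) = 1 -> (forall w, 0 <= f w) ->
  (forall c, D c -> forall w, E c w -> f w = v c) ->
  \int[P]_w f w = \esum_(c in D) (v c * P (E c)).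
Proof.
move=> mE tE E1 f0 fv; set U := \bigcup_(c in D) E c in E1.
have mU : measurable U by exact: measurable_bigcup_countType.
have U0 : P (~` U) = 0 by rewrite probability_setC // E1 subee.
rewrite (integral_full_set mU U0 f0).
pose F n := \bigcup_(c in D `&` [set c | pickle c = n]) E c.
have FE c : D c -> F (pickle c) = E c.
  move=> Dc; apply/seteqP; split=> w; last by exists c.
  by case=> c' [_ /= /(pcan_inj pickleK) ->].
have mF n : measurable (F n) by exact: measurable_bigcup_countType.
have UF : U = \bigcup_n F n.
  apply/seteqP; split=> w; last by case=> n _ [c [Dc _] Ecw]; exists c.
  by case=> c Dc Ecw; exists (pickle c) => //; rewrite FE.
have mf : measurable_fun U f.
  move=> _ Y mY; rewrite (_ : U `&` _ = \bigcup_(c in D `&` [set c | Y (v c)]) E c).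
    exact: measurable_bigcup_countType.
  apply/seteqP; split=> w.
    by move=> [[c Dc Ecw] /= Yw]; exists c => //; split=> //=; rewrite -(fv c Dc w).
  by case=> c [Dc /= Yc] Ecw; split; [exists c|rewrite /= (fv c Dc w)].
rewrite UF ge0_integral_bigcup -?UF //; last first.
  move=> m n _ _ [w [[c [Dc /= <-] Ec] [c' [Dc' /= <-] Ec']]].
  by congr pickle; apply: tE => //; exists w.
rewrite nneseries_esumT => [|n]; last exact: integral_ge0.
transitivity (\esum_(n in @pickle C @` D) \int[P]_(w in F n) f w).
  rewrite [RHS]esum_mkcond; apply: eq_esum => n _; case: ifPn => // nD.
  rewrite (_ : F n = set0) ?integral_set0 //.
  apply/seteqP; split=> // w [c [Dc /= cn] _]; move/negP: nD; apply.
  by rewrite inE; exists c.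
rewrite esum_image; last by move=> ? ? _ _; exact: (pcan_inj pickleK).
apply: eq_esum => c Dc; rewrite FE // -integral_cst //.
by apply: eq_integral => w; rewrite inE; exact: fv.
Qed.

End Integral.

Section JointPassages.
Variables (R : realType) (d L : nat) (p : R) (k : nat).
Local Notation site := (site d L).
Implicit Types (g : {ffun 'I_k -> seq site}).
Hypothesis (hd : (1 <= d)%N) (hp : 1 / 2 < p < 1).
Variables (disp : measure_display) (Om : measurableType disp)
  (P : probability Om R) (W : 'I_k -> nat -> Om -> site) (x : 'I_k -> site).
Hypothesis HW : independent_walks p P W x.

Definition joint_passages (r : int) (y : 'I_k -> site) : set {ffun 'I_k -> seq site} :=
  [set g | forall i, first_passage r (y i) (g i)].

Definition joint_sites (y : 'I_k -> site) g : set site :=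
  [set z | exists i, z \in y i :: g i].

Lemma joint_passages_trivIset r :
  trivIset (joint_passages r x) (joint_event W x).
Proof.
move=> g g' Hg Hg' [w [H H']]; apply/ffunP => i.
exact: follows_inj (Hg i) (Hg' i) (H i) (H' i).
Qed.

(** Each walk reaches level [r] outside a null set, and there are finitely many
    walks. *)
Lemma joint_passages_as r : (forall i, level (x i) <= r) ->
  P (\bigcup_(g in joint_passages r x) joint_event W x g) = 1%E.
Proof.
move=> xr; set U := \bigcup_(g in _) _.
have mU : measurable U.
  by apply: measurable_bigcup_countType => g _; exact: joint_event_measurable HW g.
pose V i := \bigcup_(s in [set s | first_passage r (x i) s])
   follows_event (W i) (x i) s.
have mV i : measurable (V i).
  apply: measurable_bigcup_countType => s _.
  exact: (follows_event_measurable (HW.1 i)).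
have V0 i : P.-negligible (~` V i).
  exists (~` V i); split=> //; first exact: measurableC.
  by rewrite probability_setC // (first_passage_as hd hp (HW.1 i)) // subee.
have N0 : P.-negligible (~` U).
  have : P.-negligible (\big[setU/set0]_(i < k) ~` V i).
    by apply: big_ind => //; [exact: negligible_set0|exact: negligibleU].
  apply: negligibleS => w UN.
  apply: contrapT => H; apply: UN.
  have HV i : exists s, first_passage r (x i) s /\ follows_event (W i) (x i) s w.
    apply: contrapT => Hs; apply: H; rewrite (bigD1 i) //=; left => -[s rs fs].
    by apply: Hs; exists s.
  have [f Hf] := boolp.choice HV.
  exists [ffun i => f i]; first by move=> i; rewrite ffunE; case: (Hf i).
  by move=> i; rewrite ffunE; case: (Hf i).
have := probability_setC P mU.
rewrite (measure_negligible (measurableC mU) N0).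
have /fineK <- := fin_num_measure P U mU.
by rewrite -EFinB => -[/eqP]; rewrite eq_sym subr_eq0 => /eqP <-.
Qed.

End JointPassages.

(** * The first-passage operator *)

Section PassageOperator.
Variables (R : realType) (d L : nat) (p : R).
Local Notation site := (site d L).
Implicit Types (x y z a : site) (s : seq site) (r n : int) (A : set site)
  (phi : site -> R).
Hypothesis (hd : (1 <= d)%N) (hp : 1 / 2 < p < 1).

Definition free_passages r A x : set (seq site) :=
  [set s | first_passage r x s /\ forall z, z \in x :: s -> ~ A z].

(** The expectation, for the walk [S] from [x], of [phi] at the hitting point of
    level [r] on the event that [S] up to that time avoids [A]. *)
Definition passage r A phi x : \bar R :=
  (\esum_(s in free_passages r A x) (weight p x s * phi (last x s))%:E)%E.

Lemma free_passages_local r A A' x : level x <= r ->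
  (forall z, level z <= r -> A z <-> A' z) ->
  free_passages r A x = free_passages r A' x.
Proof.
move=> xr AA'; apply/seteqP; split=> s [rs H]; split=> // z zs;
  have zr := first_passage_le xr rs zs; have := H z zs; by rewrite (AA' z zr).
Qed.

Lemma passage_local r A A' phi x : level x <= r ->
  (forall z, level z <= r -> A z <-> A' z) ->
  passage r A phi x = passage r A' phi x.
Proof. by move=> xr AA'; rewrite /passage (free_passages_local xr AA'). Qed.

Lemma eq_passage r A phi psi x :
  (forall s, free_passages r A x s -> phi (last x s) = psi (last x s)) ->
  passage r A phi x = passage r A psi x.
Proof. by move=> H; apply: eq_esum => s rs; rewrite H. Qed.

Lemma passageD r A phi psi x : (forall y, 0 <= phi y) -> (forall y, 0 <= psi y) ->
  passage r A (fun y => phi y + psi y) x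
  = (passage r A phi x + passage r A psi x)%E.
Proof.
move=> phi0 psi0; rewrite /passage -esumD; first last.
- by move=> s _; rewrite lee_fin mulr_ge0 ?(weight_ge0 hd hp).
- by move=> s _; rewrite lee_fin mulr_ge0 ?(weight_ge0 hd hp).
by apply: eq_esum => s _; rewrite mulrDr EFinD.
Qed.

Lemma passageZ r A c phi x : 0 <= c -> (forall y, 0 <= phi y) ->
  passage r A (fun y => c * phi y) x = (c%:E * passage r A phi x)%E.
Proof.
move=> c0 phi0; rewrite /passage -esumZl //; last first.
  by move=> s; rewrite lee_fin mulr_ge0 ?(weight_ge0 hd hp).
by apply: eq_esum => s _; rewrite -EFinM mulrCA.
Qed.

Lemma passage_gt0 r A phi x s : (forall y, 0 <= phi y) ->
  free_passages r A x s -> 0 < phi (last x s) -> (0 < passage r A phi x)%E.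
Proof.
move=> phi0 rs ps.
apply: (@lt_le_trans _ _ (weight p x s * phi (last x s))%:E).
  by rewrite lte_fin mulr_gt0 // (weight_gt0 hd hp) //; case: rs => /first_passage_path.
apply: (@esum_ge_term _ _ _ (fun s => (weight p x s * phi (last x s))%:E)) => //.
by rewrite lee_fin mulr_ge0 ?(weight_ge0 hd hp).
Qed.

Lemma free_passages_split r n A x : level x <= r -> r <= n ->
  set_bij (free_passages r A x `*`` (fun s => free_passages n A (last x s)))
    (free_passages n A x) (fun q => q.1 ++ q.2).
Proof.
move=> xr rn; split.
- move=> [s1 s2] /= [[r1 H1] [r2 H2]]; split.
    exact: first_passage_cat r1 r2.
  move=> z; rewrite -cat_cons mem_cat => /orP[/H1 //|zs].
  by apply: H2; rewrite inE zs orbT.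
- move=> [s1 s2] [s1' s2'] /set_mem[[r1 _] _] /set_mem[[r1' _] _] /= E.
  by have [E1 E2] := first_passage_cat_inj r1 r1' E; congr pair.
- move=> s [rs H]; have [s1 [s2 [E r1 r2]]] := first_passage_split xr rn rs.
  exists (s1, s2) => //=; split; split=> //= z zs; apply: H; rewrite E -cat_cons mem_cat.
    by rewrite zs.
  by move: zs; rewrite inE => /orP[/eqP->|->]; rewrite ?mem_last // orbT.
Qed.

(** The strong Markov property at the first passage to an intermediate level. *)
Lemma passage_markov r n A phi psi x : level x <= r -> r <= n ->
  (forall y, 0 <= phi y) ->
  (forall y, level y = r -> passage n A phi y = (psi y)%:E) ->
  passage n A phi x = passage r A psi x.
Proof.
move=> xr rn phi0 Hpsi; rewrite /passage (reindex_esum _ _ _ _ (free_passages_split A xr rn)).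
rewrite -(@esum_esum _ _ _ _ (fun s => free_passages n A (last x s))
   (fun s1 s2 => (weight p x (s1 ++ s2) * phi (last x (s1 ++ s2)))%:E)); last first.
  by move=> *; rewrite lee_fin mulr_ge0 ?(weight_ge0 hd hp).
apply: eq_esum => s1 [/first_passage_last r1 _].
rewrite EFinM -(Hpsi _ r1) -esumZl ?(weight_ge0 hd hp) //; last first.
  by move=> s; rewrite lee_fin mulr_ge0 ?(weight_ge0 hd hp).
by apply: eq_esum => s2 _; rewrite weight_cat last_cat -mulrA -EFinM.
Qed.

(** One way to avoid [A] from [y] is to begin with the path [s]. *)
Lemma passage_harnack r A phi y s : (forall z, 0 <= phi z) ->
  path (@adj d L) y s -> (forall z, z \in y :: s -> ~ A z /\ level z < r) ->
  ((weight p y s)%:E * passage r A phi (last y s) <= passage r A phi y)%E.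
Proof.
move=> phi0 ps H; rewrite /passage -esumZl ?(weight_ge0 hd hp) //; last first.
  by move=> s'; rewrite lee_fin mulr_ge0 ?(weight_ge0 hd hp).
rewrite (@eq_esum _ _ _ _ (fun s' => (weight p y (s ++ s') * phi (last y (s ++ s')))%:E)).
  apply: (@le_esum_inj _ _ _ _ _ (fun s' => s ++ s')
     (fun s => (weight p y s * phi (last y s))%:E)).
    move=> s' [/and3P[p' l' a'] H']; split.
      rewrite /first_passage cat_path ps p' last_cat l' belast_cat all_cat a' !andbT /=.
      by apply/allP => z /mem_belast /H [_ zr]; rewrite lt_eqF.
    move=> z; rewrite -cat_cons mem_cat => /orP[/H[]//|zs].
    by apply: H'; rewrite inE zs orbT.
  by move=> s1 s2 _ _ /= /eqP; rewrite eqseq_cat // eqxx /= => /eqP.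
by move=> s' _; rewrite weight_cat last_cat -EFinM mulrA.
Qed.

Lemma free_passages_shift a r A x :
  set_bij (free_passages r A x)
    (free_passages (r + level a) [set z | A (z - a)] (x + a))
    (map (+%R^~ a)).
Proof.
split.
- move=> s [rs H]; split; first by rewrite first_passage_shift.
  move=> z; rewrite -(map_cons (+%R^~ a)) => /mapP[z' zs ->] /=.
  by rewrite addrK; exact: H.
- by move=> s s' _ _; apply: inj_map; exact: addIr.
- move=> s [rs H]; exists (map (+%R^~ (- a)) s).
    split.
      by rewrite -(first_passage_shift a) -map_comp map_id_in // => z _ /=; rewrite addrNK.
    move=> z zs Az; apply: (H (z + a)); last by rewrite /= addrK.
    have -> : s = map (+%R^~ a) (map (+%R^~ (- a)) s).
      by rewrite -map_comp map_id_in // => z' _ /=; rewrite addrNK.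
    by rewrite -(map_cons (+%R^~ a)); apply/mapP; exists z.
  by rewrite -map_comp map_id_in // => z' _ /=; rewrite addrNK.
Qed.

End PassageOperator.

(** * Escape probabilities *)

Section Escape.
Variables (R : realType) (d L : nat) (p : R).
Local Notation site := (site d L).
Implicit Types (x y z a : site) (s : seq site) (r : int) (A : set site).
Hypothesis (hd : (1 <= d)%N) (hp : 1 / 2 < p < 1).
Variables (disp1 : measure_display) (Om1 : measurableType disp1)
  (P1 : site -> probability Om1 R) (S : nat -> Om1 -> site).
Hypothesis hS : forall x, random_walk p (P1 x) S x.

Definition escape r A x : R := fine (P1 x (avoids S r A)).

Lemma escape_EFin r A x : (escape r A x)%:E = P1 x (avoids S r A).
Proof. by rewrite fineK // fin_num_measure //; exact: avoids_measurable (hS x) r A. Qed.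

Lemma escapeE r A x : level x <= r ->
  (escape r A x)%:E = passage p r A (fun=> 1) x.
Proof.
move=> xr; rewrite escape_EFin (avoids_prob hd hp (hS x)) //.
by apply: eq_esum => s _; rewrite mulr1.
Qed.

Lemma escape_ge0 r A x : 0 <= escape r A x.
Proof. exact: fine_ge0. Qed.

Lemma escape_le1 r A x : escape r A x <= 1.
Proof.
rewrite -lee_fin escape_EFin probability_le1 //.
exact: avoids_measurable (hS x) r A.
Qed.

Lemma escape_gt0P r A x : level x <= r ->
  0 < escape r A x <-> exists s, free_passages r A x s.
Proof.
move=> xr; rewrite -lte_fin escapeE //; split=> [H|[s rs]]; last first.
  exact: (@passage_gt0 _ _ _ _ hd hp r A (fun=> 1) x s).
apply: contrapT => E; move: H; rewrite /passage.
rewrite (_ : free_passages r A x = set0) ?esum_set0 ?ltxx //.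
by apply/seteqP; split=> // s rs; apply: E; exists s.
Qed.

Lemma escape_markov r n A x : level x <= r -> r <= n ->
  (escape n A x)%:E = passage p r A (escape n A) x.
Proof.
move=> xr rn; rewrite escapeE ?(le_trans xr) //.
by apply: (passage_markov hd hp) => // y yr; rewrite escapeE // yr.
Qed.

Lemma escape_anti r n A A' x : level x <= r -> r <= n -> A `<=` A' ->
  escape n A' x <= escape r A x.
Proof.
move=> xr rn AA'; rewrite -lee_fin (escape_markov A' xr rn) (escapeE A xr).
apply: (@le_trans _ _ (passage p r A' (fun=> 1) x)).
  apply: le_esum => s _.
  by rewrite lee_fin ler_wpM2l ?(weight_ge0 hd hp) ?escape_le1.
by apply: esum_subset => s [rs H]; split=> // z zs /AA'; exact: H.
Qed.

Lemma escape_shift a r A x : level x <= r ->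
  escape (r + level a) [set z | A (z - a)] (x + a) = escape r A x.
Proof.
move=> xr; apply: EFin_inj; rewrite !escapeE ?levelD ?lerD2r //.
rewrite /passage (reindex_esum _ _ _ _ (free_passages_shift a r A x)).
by apply: eq_esum => s _; rewrite weight_shift.
Qed.

(** On the event that the walk reaches level [n], of probability one, its path to
    level [n] contains its path to level [0]. *)
Lemma escape_setI n A A' x : level x <= 0 -> A `<=` A' ->
  P1 x (avoids S n%:Z A' `&` avoids S 0 A) = P1 x (avoids S n%:Z A').
Proof.
move=> x0 AA'; have xn : level x <= n%:Z by apply: le_trans x0 _.
set U := \bigcup_(s in [set s | first_passage n%:Z x s]) follows_event S x s.
have mU : measurable U.
  apply: measurable_bigcup_countType => s _.
  exact: (follows_event_measurable (hS x)).
have m1 := avoids_measurable (hS x) n%:Z A'.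
have m2 := avoids_measurable (hS x) 0 A.
have U1 := first_passage_as hd hp (hS x) xn.
rewrite -(measure_setI_full (measurableI _ _ m1 m2) mU U1).
rewrite -[RHS](measure_setI_full m1 mU U1); congr (P1 x _).
apply/seteqP; split=> w [H1 H2]; split=> //; first by case: H1.
split=> //; case: H2 => s /= rs fs.
have [s1 [s2 [E r1 r2]]] := first_passage_split x0 (isT : 0 <= n%:Z) rs.
have f1 : follows (S ^~ w) x s1.
  move=> t ts; rewrite fs E ?size_cat ?ltn_addr //; last first.
    by rewrite (leq_trans ts) // leq_addr.
  by rewrite -cat_cons nth_cat /= ltnS ts.
apply/seteqP; split=> // z; rewrite (visited_follows r1 f1) => -[/= zs Az].
suff : (visited n%:Z (S ^~ w) `&` A') z by rewrite H1.
split; last exact: AA'.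
by rewrite (visited_follows rs fs) /= E -cat_cons mem_cat zs.
Qed.

(** The filter along which the limit that defines [Z_n] is taken. *)
Definition low_starts A : set_system site := within (admissible P1 S A) (@level_to_ninfty d L).

Global Instance level_to_ninfty_filter : Filter (@level_to_ninfty d L).
Proof.
apply: filter_from_filter; first by exists 0%N.
move=> i j _ _; exists (maxn i j) => // x /= H; clear -H; split; lia.
Qed.

Global Instance low_filter A : Filter (low_starts A).
Proof. exact: within_filter. Qed.

Definition reachable A := forall m : nat,
  exists2 x, level x <= - m%:Z & admissible P1 S A x.

Lemma low_proper A : reachable A -> ProperFilter (low_starts A).
Proof.
move=> rA; apply: Build_ProperFilter_ex => B [m _ HB].
by have [x xm xA] := rA m; exists x; exact: HB.
Qed.

Lemma near_low A (m : nat) : \forall x \near low_starts A,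
  level x <= - m%:Z /\ 0 < escape 0 A x.
Proof.
exists m => // x /= xm; rewrite /admissible /= -escape_EFin lte_fin.
by split.
Qed.

Lemma reachableP A : reachable A <-> forall m : nat,
  exists2 x, level x <= - m%:Z & 0 < escape 0 A x.
Proof.
by split=> H m; have [x xm Ax] := H m; exists x => //; move: Ax;
  rewrite /admissible /= -escape_EFin lte_fin.
Qed.

Definition escape_ratio n A A' x : R := escape n A' x / escape 0 A x.

Lemma escape_ratioE n A A' x :
  escape_ratio n A A' x = escape n A' x / escape 0 A x.
Proof. by []. Qed.

Lemma cond_prob_ratio n A A' : A `<=` A' ->
  {near low_starts A, (fun x => cond_prob (P1 x) (avoids S n%:Z A') (avoids S 0 A))
      =1 escape_ratio n%:Z A A'}.
Proof.
move=> AA'; near=> x.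
have [x0 _] : level x <= - 0%N%:Z /\ 0 < escape 0 A x by near: x; exact: near_low.
by rewrite /cond_prob escape_setI // -oppr0.
Unshelve. all: by end_near. Qed.

Lemma Zfilter_cvg n A A' (l : R) : A `<=` A' ->
  (Zfilter P1 S n A A' --> l) <-> (escape_ratio n%:Z A A' x @[x --> low_starts A] --> l).
Proof.
move=> AA'; have E := cond_prob_ratio n AA'.
have E' : {near low_starts A, escape_ratio n%:Z A A' =1
    (fun x => cond_prob (P1 x) (avoids S n%:Z A') (avoids S 0 A))}.
  by apply: filterS E => x.
by split=> H; apply: cvg_trans H; exact: near_eq_cvg.
Qed.

Lemma Zlim_ratio n A A' (l : R) : reachable A -> A `<=` A' ->
  escape_ratio n%:Z A A' x @[x --> low_starts A] --> l -> Zlim P1 S n A A' = l.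
Proof.
move=> rA AA' H; have PF := low_proper rA.
by apply: cvg_lim; [exact: norm_hausdorff|exact/Zfilter_cvg].
Qed.

End Escape.

(** * Components of the free region *)

Section Components.
Variables (d L : nat).
Local Notation site := (site d L).
Implicit Types (x y z a : site) (s : seq site) (r : int) (A B : set site).

Lemma connected_in_trans A y z x :
  connected_in A x y -> connected_in A y z -> connected_in A x z.
Proof.
move=> [s [ps ls Hs]] [s' [ps' ls' Hs']]; exists (s ++ s').
rewrite cat_path last_cat ls ps ps' ls'; split=> // v.
rewrite -cat_cons mem_cat => /orP[/Hs //|vs]; apply: Hs'.
by rewrite inE vs orbT.
Qed.

Lemma connected_in_sym A x y : connected_in A x y -> connected_in A y x.
Proof.
move=> [s [ps ls Hs]]; exists (rev (belast x s)); split.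
- by rewrite -ls rev_path (eq_path (e' := @adj d L)) // => u v; rewrite /= adj_sym.
- rewrite -ls; case: s {ps ls Hs} => //= v s; rewrite rev_cons last_rcons //.
- move=> v; rewrite -ls => vs; apply: Hs; rewrite lastI mem_rcons.
  by move: vs; rewrite !inE mem_rev.
Qed.

Lemma connected_in_sub A B x y : A `<=` B -> connected_in A x y ->
  connected_in B x y.
Proof. by move=> AB [s [ps ls Hs]]; exists s; split=> // v /Hs /AB. Qed.

Lemma connected_in_l A x y : connected_in A x y -> A x.
Proof. by move=> [s [_ _ Hs]]; apply: Hs; rewrite mem_head. Qed.

Definition free_below r A : set site := [set z | level z <= r] `\` A.

Lemma free_passages_connected r A x s : level x <= r -> free_passages r A x s ->
  connected_in (free_below r A) x (last x s).
Proof.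
move=> xr [rs H]; exists s; split=> //; first exact: first_passage_path rs.
by move=> v vs; split; [exact: first_passage_le rs vs|exact: H].
Qed.

Lemma connected_free_passages r A x w : level w = r ->
  connected_in (free_below r A) x w ->
  exists s, free_passages r A x s /\ connected_in (free_below r A) x (last x s).
Proof.
move=> wr C; have [xr _] := connected_in_l C; case: C => s [ps ls Hs].
have [|s1 [s2 [E rs]]] := path_first_passage ps xr; first by rewrite ls wr.
have fs : free_passages r A x s1.
  by split=> // z zs; have [] // := Hs z; rewrite E -cat_cons mem_cat zs.
by exists s1; split=> //; exact: free_passages_connected fs.
Qed.

(** [free_component] for any top level [r] and any obstacle [A]: the top level
    [1] is needed once the configuration has been extended. *)
Definition far_component r A : set site :=
  [set z | (exists2 w, level w = r & connected_in (free_below r A) z w) /\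
    (forall m : nat, exists2 w, level w <= - m%:Z &
       connected_in (free_below r A) z w)].

Lemma free_componentE (gam : int -> seq site) :
  free_component gam = far_component 0 (trace0 gam).
Proof. by []. Qed.

Lemma far_component_connected r A z w : far_component r A z ->
  connected_in (free_below r A) z w -> far_component r A w.
Proof.
move=> [[u ur zu] H] zw; have wz := connected_in_sym zw.
split; first by exists u => //; exact: connected_in_trans wz zu.
by move=> m; have [v vm zv] := H m; exists v => //; exact: connected_in_trans wz zv.
Qed.

Lemma far_component_free_below r A : far_component r A `<=` free_below r A.
Proof. by move=> z [[w _ /connected_in_l]]. Qed.

Lemma far_component_levels r A j : far_component r A !=set0 -> j <= r ->
  exists2 z, far_component r A z & level z = j.
Proof.
move=> [z0 D0] jr; have [[w wr zw] H] := D0; have [v vj zv] := H `|j|%N.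
have vD := far_component_connected D0 zv.
have [s [ps ls Hs]] := connected_in_trans (connected_in_sym zv) zw.
have vj' : level v <= j by lia.
have [|s1 [s2 [E rs]]] := path_first_passage ps vj'; first by rewrite ls wr.
exists (last v s1); last exact: first_passage_last rs.
apply: (far_component_connected vD); exists s1; split=> //.
  exact: first_passage_path rs.
by move=> u us; apply: Hs; rewrite E -cat_cons mem_cat us.
Qed.

(** Level [r] is finite, so the components of the free region that meet it and
    are bounded below have a common lower bound. *)
Lemma far_component_deep r A : exists M : nat, forall x w, level x <= - M%:Z ->
  level w = r -> connected_in (free_below r A) x w -> far_component r A x.
Proof.
have H (y : torus d L) : exists m : nat,
    (forall m' : nat, exists2 v, level v <= - m'%:Z &
       connected_in (free_below r A) (r, y) v) \/
    (forall v, connected_in (free_below r A) (r, y) v -> - m%:Z < level v).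
  have [?|/existsNP[m Hm]] := pselect (forall m' : nat, exists2 v,
    level v <= - m'%:Z & connected_in (free_below r A) (r, y) v).
    by exists 0%N; left.
  exists m; right => v yv; rewrite ltNge; apply/negP => vm.
  by apply: Hm; exists v.
have [m Hm] := boolp.choice H; exists (\max_y m y)%N => x w xM wr xw.
have we : w = (r, w.2) by case: w wr {xw} => ? ? /= <-.
have wx : connected_in (free_below r A) (r, w.2) x.
  by rewrite -we; exact: connected_in_sym.
have [low|/(_ x wx)] := Hm w.2; last first.
  have : (m w.2 <= \max_y m y)%N := leq_bigmax w.2.
  by move: xM; lia.
split; first by exists w.
move=> m'; have [v vm wv] := low m'; exists v => //.
exact: connected_in_trans (connected_in_sym wx) wv.
Qed.

(** A path in a slice without repetitions visits at most once each point of the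
    torus. *)
Lemma connected_in_slice_short (D : set site) j x y :
  connected_in (slice D j) x y ->
  exists s, [/\ path (@adj d L) x s, last x s = y, (size s <= #|torus d L|)%N
    & forall v, v \in x :: s -> slice D j v].
Proof.
move=> [s [ps ls Hs]]; move: ls; case/shortenP: ps => s' ps' us' sub ls.
exists s'; split=> //; last first.
  move=> v vs; apply: Hs; move: vs; rewrite !inE => /orP[->//|/sub ->].
  by rewrite orbT.
have inj : {in x :: s' &, injective (@snd int (torus d L))}.
  have lev v : v \in x :: s' -> v.1 = j.
    move=> vs; have [] // := Hs v _.
    by move: vs; rewrite !inE => /orP[->//|/sub ->]; rewrite orbT.
  by move=> [u1 u2] [v1 v2] /lev /= -> /lev /= -> ->.
have : uniq (map snd (x :: s')) by rewrite map_inj_in_uniq.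
move/card_uniqP; rewrite size_map /= => E.
by have := max_card [in map snd (x :: s')]; rewrite E => /ltnW.
Qed.

End Components.

(** * Contraction at connected slices *)

Section Contraction.
Variables (R : realType) (d L : nat) (p : R).
Local Notation site := (site d L).
Implicit Types (x y z : site) (s : seq site) (i j : int) (u v h : site -> R).
Hypothesis (hd : (1 <= d)%N) (hp : 1 / 2 < p < 1).
Variable A : set site.
Local Notation D := (far_component 0 A).

(** The mean value property on the component and below level [j]: the walk that
    starts in the component and avoids [A] stays there until it reaches its target
    level, so this is a condition on the values of [h] in the component. *)
Definition passage_harmonic j h := (forall y, 0 <= h y) /\
  forall y i, D y -> level y <= i -> i <= j -> passage p i A h y = (h y)%:E.

Lemma free_passages_far_component i y s : i <= 0 -> D y -> level y <= i ->
  free_passages i A y s -> D (last y s) /\ level (last y s) = i.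
Proof.
move=> i0 Dy yi fs; split; last by case: fs => /first_passage_last.
have C := free_passages_connected yi fs.
apply: (far_component_connected Dy); apply: connected_in_sub C => z [zi nA].
by split=> //; apply: le_trans i0.
Qed.

Lemma harmonic_le i j u v : i <= j -> i <= 0 -> passage_harmonic j u -> passage_harmonic j v ->
  (forall y, D y -> level y = i -> u y <= v y) ->
  forall y, D y -> level y <= i -> u y <= v y.
Proof.
move=> ij i0 [_ Hu] [_ Hv] uv y Dy yi.
rewrite -lee_fin -(Hu y i) // -(Hv y i) //; apply: le_esum => s fs.
have [Ds ls] := free_passages_far_component i0 Dy yi fs.
by rewrite lee_fin ler_wpM2l ?(weight_ge0 hd hp) ?uv.
Qed.

Lemma harmonicZ j c h : 0 <= c -> passage_harmonic j h -> passage_harmonic j (fun y => c * h y).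
Proof.
move=> c0 [h0 H]; split=> [y|y i Dy yi ij]; first exact: mulr_ge0.
by rewrite (passageZ hd hp) // H // EFinM.
Qed.

(** Since the difference is nonnegative only in the component and below level
    [j], it is replaced by zero elsewhere. *)
Lemma harmonicB j u v : j <= 0 -> passage_harmonic j u -> passage_harmonic j v ->
  (forall y, D y -> level y <= j -> u y <= v y) ->
  exists2 g, passage_harmonic j g & forall y, D y -> level y <= j -> g y = v y - u y.
Proof.
move=> j0 [u0 Hu] [v0 Hv] uv.
pose g y := if `[< D y /\ level y <= j >] then v y - u y else 0.
have gE y : D y -> level y <= j -> g y = v y - u y.
  by move=> Dy yj; rewrite /g ifT //; apply/asboolP.
exists g => //; split=> [y|y i Dy yi ij].
  by rewrite /g; case: ifPn => // /asboolP[Dy yj]; rewrite subr_ge0 uv.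
have g0 z : 0 <= g z.
  by rewrite /g; case: ifPn => // /asboolP[Dz zj]; rewrite subr_ge0 uv.
have := Hv y i Dy yi ij.
rewrite (@eq_passage _ _ _ _ _ _ _ (fun z => g z + u z)) => [|s fs]; last first.
  have [Ds ls] := free_passages_far_component (le_trans ij j0) Dy yi fs.
  by rewrite gE ?ls // subrK.
rewrite (passageD hd hp) // Hu // gE ?(le_trans yi) //.
by move=> /(congr1 (fun e => (e - (u y)%:E)%E)); rewrite addeK // => ->.
Qed.

Definition slice_constant : R := ellipticity d p ^+ #|torus d L|.

Lemma slice_constant_gt0 : 0 < slice_constant.
Proof. by rewrite exprn_gt0 // (ellipticity_gt0 hd hp). Qed.

Lemma ellipticity_le1 : ellipticity d p <= 1.
Proof.
case/andP: hp => p0 p1; rewrite /ellipticity ler_pdivrMr ?mulr_gt0 ?ltr0n //.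
by have : 1 <= d%:R :> R; [rewrite ler1n|lra].
Qed.

Lemma slice_constant_le1 : slice_constant <= 1.
Proof. by rewrite exprn_ile1 ?ellipticity_le1 // ltW // (ellipticity_gt0 hd hp). Qed.

(** Inside a connected slice the walk can go from [y] to [z] before rising. *)
Lemma slice_harnack i j h y z : i < j -> j <= 0 -> passage_harmonic j h ->
  graph_connected (slice D i) -> slice D i y -> slice D i z ->
  slice_constant * h z <= h y.
Proof.
move=> ij j0 [h0 H] conn Dy Dz.
have [s [ps ls ss Hs]] := connected_in_slice_short (conn y z Dy Dz).
case: Dy Dz => [Dy yi] [Dz zi]; rewrite /= in yi zi.
have off x : x \in y :: s -> ~ A x /\ level x < j.
  move=> /Hs [Dx /= ->]; split=> //.
  by have [] := far_component_free_below Dx.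
have := passage_harnack hd hp h0 ps off.
rewrite ls !H ?yi ?zi ?(ltW ij) // -EFinM lee_fin; apply: le_trans.
rewrite ler_wpM2r //; apply: le_trans (weight_ge_ellipticity hd hp ps).
by rewrite ler_wiXn2l ?ellipticity_le1 // ltW // (ellipticity_gt0 hd hp).
Qed.

Definition contraction_rate : R := 1 - slice_constant ^+ 2 / 2.

Lemma contraction_rate_ge0 : 0 <= contraction_rate.
Proof.
rewrite /contraction_rate; have := slice_constant_gt0; have := slice_constant_le1.
by move=> ? ?; rewrite subr_ge0; nra.
Qed.

Lemma contraction_rate_lt1 : contraction_rate < 1.
Proof.
have := slice_constant_gt0; rewrite /contraction_rate => ?.
by rewrite ltrBlDr ltrDl divr_gt0 // exprn_gt0.
Qed.

(** A connected slice narrows the range of the ratio of two harmonic functions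
    by a fixed factor: at one of its points the ratio is in the upper or in the
    lower half of its range, and the Harnack inequality for [v - a u] or for
    [b u - v] moves that information to the whole slice. *)
Lemma slice_contraction i j u v (a b : R) : i < j -> j <= 0 -> D !=set0 ->
  passage_harmonic j u -> passage_harmonic j v -> graph_connected (slice D i) ->
  0 <= a -> a <= b ->
  (forall y, D y -> level y <= j -> a * u y <= v y <= b * u y) ->
  exists a' b', [/\ 0 <= a', a' <= b', b' - a' = contraction_rate * (b - a) &
    forall y, D y -> level y <= i -> a' * u y <= v y <= b' * u y].
Proof.
move=> ij j0 Dn Hu Hv conn a0 ab bnd.
have ij' := ltW ij; have i0 := le_trans ij' j0.
have b0 := le_trans a0 ab.
have [g1 Hg1 g1E] : exists2 g, passage_harmonic j g &
    forall y, D y -> level y <= j -> g y = v y - a * u y.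
  by apply: harmonicB => //; [exact: harmonicZ|move=> y Dy /(bnd y Dy)/andP[]].
have [g2 Hg2 g2E] : exists2 g, passage_harmonic j g &
    forall y, D y -> level y <= j -> g y = b * u y - v y.
  by apply: harmonicB => //; [exact: harmonicZ|move=> y Dy /(bnd y Dy)/andP[]].
have [z Dz zi] := far_component_levels Dn i0.
have c0 := slice_constant_gt0; have c1 := slice_constant_le1.
set c := slice_constant in c0 c1; pose w := (b - a) / 2.
have w0 : 0 <= w by rewrite /w; lra.
have spread g : passage_harmonic j g -> w * u z <= g z ->
    forall y, D y -> level y = i -> c ^+ 2 * w * u y <= g y.
  move=> Hg wg y Dy yi.
  have h1 := slice_harnack ij j0 Hg conn (conj Dy yi) (conj Dz zi).
  have h2 := slice_harnack ij j0 Hu conn (conj Dz zi) (conj Dy yi).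
  apply: le_trans h1; rewrite -/c.
  apply: (@le_trans _ _ (c * (w * u z))); last by rewrite ler_pM2l.
  have -> : c ^+ 2 * w * u y = c * (w * (c * u y)) by ring.
  by rewrite ler_pM2l // ler_wpM2l.
have cc : c ^+ 2 <= 1 by rewrite exprn_ile1 // ltW.
have cc0 : 0 < c ^+ 2 by rewrite exprn_gt0.
have gap : b - a - c ^+ 2 * w = contraction_rate * (b - a).
  by rewrite /contraction_rate -/c /w; field.
have [wz|wz] := leP (w * u z) (g1 z).
- exists (a + c ^+ 2 * w), b; split; first by nra.
  + by rewrite /w; nra.
  + by rewrite -gap; ring.
  + move=> y Dy yi; have yj := le_trans yi ij'; have /andP[_ ->] := bnd y Dy yj.
    rewrite andbT.
    apply: (harmonic_le ij' i0 (harmonicZ (_ : 0 <= a + c ^+ 2 * w) Hu) Hv) => //.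
      by nra.
    move=> {yi yj}y {}Dy yi; have := spread g1 Hg1 wz y Dy yi.
    by rewrite g1E // ?yi // mulrDl; lra.
- exists a, (b - c ^+ 2 * w); split=> //; first by rewrite /w; nra.
    by rewrite -gap; ring.
  move=> y Dy yi; have yj := le_trans yi ij'; have /andP[-> _] := bnd y Dy yj.
  have wz2 : w * u z <= g2 z.
    by move: wz; rewrite g1E ?g2E ?zi // /w; lra.
  have bc : 0 <= b - c ^+ 2 * w by rewrite /w; nra.
  apply: (harmonic_le ij' i0 Hv (harmonicZ bc Hu)) => //.
  move=> {yi yj}y {}Dy yi; have := spread g2 Hg2 wz2 y Dy yi.
  by rewrite g2E // ?yi // mulrBl; lra.
Qed.

End Contraction.

(** * Convergence of the ratio for one path *)

Section OnePath.
Variables (R : realType) (d L : nat) (p : R).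
Local Notation site := (site d L).
Implicit Types (x y z : site) (s : seq site) (A : set site).
Hypothesis (hd : (1 <= d)%N) (hp : 1 / 2 < p < 1).
Variables (disp1 : measure_display) (Om1 : measurableType disp1)
  (P1 : site -> probability Om1 R) (S : nat -> Om1 -> site).
Hypothesis hS : forall x, random_walk p (P1 x) S x.
Local Notation escape := (escape P1 S).
Local Notation escape_ratio := (escape_ratio P1 S).
Local Notation low_starts := (low_starts P1 S).

Lemma escape_gt0_connected r A x : level x <= r ->
  0 < escape r A x <->
  exists2 w, level w = r & connected_in (free_below r A) x w.
Proof.
move=> xr; rewrite (escape_gt0P hd hp hS) //; split=> [[s fs]|[w wr C]].
  exists (last x s); last exact: free_passages_connected.
  by case: fs => /first_passage_last.
by have [s [fs _]] := connected_free_passages wr C; exists s.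
Qed.

Lemma escape_harmonic (n j : int) A A' : 0 <= n -> j <= 0 ->
  (forall z, level z <= j -> A z <-> A' z) -> passage_harmonic p A j (escape n A').
Proof.
move=> n0 j0 AA'; split=> [y|y i Dy yi ij]; first exact: escape_ge0.
rewrite (escape_markov hd hp hS A' yi); last by apply: le_trans n0; apply: le_trans j0.
by apply: passage_local => // z zi; apply: AA'; apply: le_trans ij.
Qed.

Lemma far_component_reachable A : far_component 0 A !=set0 ->
  reachable P1 S A.
Proof.
move=> Dn; apply/(reachableP hS) => m.
have m0 : - m%:Z <= 0 :> int by lia.
have [z Dz zm] := far_component_levels Dn m0.
exists z; first by rewrite zm.
by apply/escape_gt0_connected; [rewrite zm|case: Dz].
Qed.

(** A start that can avoid [A] is joined to level [0]; if it is low enough, its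
    component is unbounded. *)
Lemma near_low_component A : \forall x \near low_starts A, far_component 0 A x.
Proof.
have [M HM] := far_component_deep 0 A.
have nl := near_low hS A M; near=> x.
have [xM f0] : level x <= - M%:Z /\ 0 < escape 0 A x by near: x.
have x0 : level x <= 0 by lia.
have [w wr C] := (escape_gt0_connected A x0).1 f0.
exact: HM xM wr C.
Unshelve. all: by end_near. Qed.

Definition often_connected A := forall m : nat, exists2 j : nat, (m < j)%N &
  graph_connected (slice (far_component 0 A) (- j%:Z)).

(** One contraction for each of [N] connected slices, starting from the bounds [0]
    and [1] at a level below which [A] and [A'] agree. *)
Lemma ratio_bounds (n : nat) A A' (j : nat) : far_component 0 A !=set0 ->
  often_connected A -> A `<=` A' ->
  (forall z, level z <= - j%:Z -> A z <-> A' z) ->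
  forall N, exists (i : nat) (a b : R), [/\ (j <= i)%N, 0 <= a <= b,
    b - a = contraction_rate d L p ^+ N & forall y, far_component 0 A y ->
    level y <= - i%:Z ->
    a * escape 0 A y <= escape n%:Z A' y <= b * escape 0 A y].
Proof.
move=> Dn oc sub AA'; elim=> [|N [i [a [b [ji /andP[a0 ab] ba bnd]]]]].
  exists j, 0, 1; split; rewrite ?subr0 ?ler01 ?lexx // => y Dy yj.
  rewrite mul0r mul1r escape_ge0 /=; apply: (escape_anti hd hp hS) => //.
  by lia.
have [i' ii' conn] := oc i.
have Hu : passage_harmonic p A (- i%:Z) (escape 0 A).
  by apply: escape_harmonic => //; lia.
have Hv : passage_harmonic p A (- i%:Z) (escape n%:Z A').
  by apply: escape_harmonic => // z zi; apply: AA'; lia.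
have [||a' [b' [a'0 a'b' E bnd']]] :=
  slice_contraction hd hp _ _ Dn Hu Hv conn a0 ab bnd; [lia|lia|].
exists i', a', b'; split=> //; first by lia.
  by rewrite a'0 a'b'.
by rewrite E ba exprS.
Qed.

(** By the contraction at each connected slice, the ratio is eventually
    confined to arbitrarily short intervals, so it converges. *)
Lemma ratio_cvg (n : nat) A A' (j : nat) : far_component 0 A !=set0 ->
  often_connected A -> A `<=` A' ->
  (forall z, level z <= - j%:Z -> A z <-> A' z) ->
  cvg (escape_ratio n%:Z A A' x @[x --> low_starts A]).
Proof.
move=> Dn oc sub AA'.
have PF := low_proper (far_component_reachable Dn).
apply/cauchy_cvgP; apply/cauchy_exP => e e0.
have [N Ne] : exists N, contraction_rate d L p ^+ N < e.
  have : contraction_rate d L p ^+ N @[N --> \oo] --> (0 : R).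
    apply: cvg_expr; rewrite ger0_norm ?contraction_rate_lt1 //.
    exact: contraction_rate_ge0 hd hp.
  by move/cvgr_lt => /(_ e e0) [N _ HN]; exists N; apply: (HN N); exact: leqnn.
have [i [a [b [ji ab ba bnd]]]] := ratio_bounds n Dn oc sub AA' N.
exists a; have H1 := near_low hS A i; have H2 := near_low_component A.
rewrite /ball_ /=; near=> x.
have [xi f0] : level x <= - i%:Z /\ 0 < escape 0 A x by near: x.
have Dx : far_component 0 A x by near: x.
have /andP[h1 h2] := bnd x Dx xi.
have r1 : a <= escape_ratio n%:Z A A' x by rewrite ler_pdivlMr.
have r2 : escape_ratio n%:Z A A' x <= b by rewrite ler_pdivrMr.
by rewrite /ball /= ltr_norml; apply/andP; split; lra.
Unshelve. all: by end_near. Qed.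

End OnePath.

(** * Configurations and their extensions *)

Section Trajectories.
Variables (d L : nat).
Local Notation site := (site d L).
Implicit Types (x y z : site) (s : seq site).

Lemma trajectory_first_passage (r : int) (f : nat -> site) :
  (forall t, adj (f t) (f t.+1)) -> (exists t, level (f t) = r) ->
  exists s, first_passage r (f 0%N) s /\ follows f (f 0%N) s.
Proof.
move=> fadj [t]; elim: t f fadj => [|t IH] f fadj ft.
  exists [::]; rewrite first_passage_nil ft eqxx; split=> //.
  by rewrite /follows; case.
have [f0|f0] := eqVneq (level (f 0%N)) r.
  exists [::]; rewrite first_passage_nil f0 eqxx; split=> //.
  by rewrite /follows; case.
have [|s [rs fs]] := IH (fun t => f t.+1) _ ft; first by [].
exists (f 1%N :: s); rewrite first_passage_cons f0 fadj rs; split=> //.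
by apply/follows_cons.
Qed.

End Trajectories.

Section Configurations.
Variables (d L k : nat).
Local Notation site := (site d L).
Implicit Types (x y z : site) (s : seq site) (Gam : 'I_k -> int -> seq site)
  (g : {ffun 'I_k -> seq site}).

Lemma crossingE (i : int) z s :
  crossing i (z :: s) = (level z == i - 1) && first_passage i z s.
Proof. by []. Qed.

Lemma trace0_level (gam : int -> seq site) z :
  half_infinite 0 gam -> trace0 gam z -> level z <= 0.
Proof.
move=> H [j j0]; have [] := H j j0; case: (gam j) => // y s.
rewrite crossingE => /andP[/eqP yj fs] _ zs.
by apply: le_trans j0; apply: first_passage_le fs zs; lia.
Qed.

Lemma sites0_level Gam z : configuration Gam -> sites0 Gam z -> level z <= 0.
Proof. by move=> cG [i _]; exact: trace0_level. Qed.

Lemma endpoints_level Gam i : configuration Gam -> level (endpoints Gam i) = 0.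
Proof.
move=> cG; have [] := cG i 0 (lexx _); rewrite /endpoints /finish.
by case: (Gam i 0) => // y s; rewrite crossingE => /andP[_ /first_passage_last].
Qed.

Lemma endpoints_sites0 Gam i : configuration Gam -> sites0 Gam (endpoints Gam i).
Proof.
move=> cG; exists i => //; exists 0 => //.
have [] := cG i 0 (lexx _); rewrite /endpoints /finish.
by case: (Gam i 0) => // y s _ _; rewrite [last _ _]/=; exact: mem_last.
Qed.

Lemma ord_eq1 (i0 : 'I_k) : k == 1%N -> forall i, i = i0.
Proof.
by move=> /eqP k1 i; apply/val_inj => /=; move: (ltn_ord i) (ltn_ord i0); lia.
Qed.

Lemma sites0_one Gam : k == 1%N -> forall i, sites0 Gam = trace0 (Gam i).
Proof.
move=> k1 i; apply/seteqP; split=> z; last by exists i.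
by case=> i' _; rewrite (ord_eq1 i k1 i').
Qed.

(** [extend] in terms of the finite paths that the attached walks follow until
    they stop. *)
Definition extension_sites Gam g : set site :=
  sites0 Gam `|` joint_sites (endpoints Gam) g.

Lemma extend_follows Gam (n : nat) (f : 'I_k -> nat -> site) g :
  joint_passages n%:Z (endpoints Gam) g ->
  (forall i, follows (f i) (endpoints Gam i) (g i)) ->
  extend Gam n f = extension_sites Gam g.
Proof.
move=> Hg Hf; congr (_ `|` _); apply/seteqP; split=> z.
  by case=> i _; rewrite (visited_follows (Hg i) (Hf i)) => zs; exists i.
by case=> i zs; exists i => //; rewrite (visited_follows (Hg i) (Hf i)).
Qed.

(** Finitely many finite paths are bounded below. *)
Lemma joint_sites_deep (e : 'I_k -> site) (r : int) g : (forall i, level (e i) = 0) ->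
  joint_passages r e g ->
  exists j : nat, forall z, joint_sites e g z -> - j%:Z < level z.
Proof.
move=> e0 Hg; exists (\max_i size (g i)).+1 => z [i zs].
have := path_levels (first_passage_path (Hg i)) zs; rewrite e0.
have : (size (g i) <= \max_i size (g i))%N := leq_bigmax i.
by lia.
Qed.

(** The configuration extended by the paths [g] to level [1], seen from there: all
    pieces are shifted down by one level, and [g] provides the new crossings to
    level [0]. *)
Definition advance Gam g : 'I_k -> int -> seq site := fun i j =>
  map (+%R^~ (- up d L)) (if j == 0 then endpoints Gam i :: g i else Gam i (j + 1)).

Lemma crossing_shift (a : site) (i : int) s :
  crossing (i + level a) (map (+%R^~ a) s) = crossing i s.
Proof.
case: s => // z s; rewrite /= -[RHS]crossingE -[LHS]/(crossing _ (_ :: _)).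
by rewrite !crossingE first_passage_shift levelD addrAC (inj_eq (addIr _)).
Qed.

Lemma level_opp_up : level (- up d L) = -1.
Proof. by []. Qed.

Lemma finish_shift (a : site) s : s != [::] ->
  finish (map (+%R^~ a) s) = finish s + a.
Proof. by case: s => // z s _; rewrite /finish /= (last_map (+%R^~ a)). Qed.

Lemma start_shift (a : site) s : s != [::] ->
  start (map (+%R^~ a) s) = start s + a.
Proof. by case: s. Qed.

Lemma crossing_nil (i : int) s : crossing i s -> s != [::].
Proof. by case: s. Qed.

Lemma advance_configuration Gam g : configuration Gam ->
  joint_passages 1 (endpoints Gam) g -> configuration (advance Gam g).
Proof.
move=> cG Hg i j j0; have jf : (j - 1 == 0) = false by lia.
rewrite /advance jf.
rewrite subrK; have [c _] := cG i j j0.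
have [->|jn0] := eqVneq j 0; last first.
  have j1 : j + 1 <= 0 by move/eqP in jn0; lia.
  have [c' E] := cG i (j + 1) j1; rewrite addrK in E.
  rewrite -[X in crossing X](addrK 1 j) -level_opp_up crossing_shift; split=> //.
  by rewrite finish_shift ?(crossing_nil c) // start_shift ?(crossing_nil c') // E.
have [c0 _] := cG i 0 (lexx _).
split; last by rewrite finish_shift ?(crossing_nil c0).
rewrite -[X in crossing X](addrK 1 (0 : int)) -level_opp_up crossing_shift crossingE.
by rewrite add0r subrr endpoints_level // eqxx; exact: Hg.
Qed.

Lemma advance_sites0 Gam g :
  sites0 (advance Gam g) = [set z | extension_sites Gam g (z + up d L)].
Proof.
have mem_shift z s : (z \in map (+%R^~ (- up d L)) s) = (z + up d L \in s).
  by rewrite -{1}(addrK (up d L) z) (mem_map (addIr _)).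
apply/seteqP; split=> z /=.
  case=> i _ [j j0]; rewrite /advance mem_shift; case: ifP => [_ zs|jn0 zs].
    by right; exists i.
  left; exists i => //; exists (j + 1) => //.
  by move/eqP in jn0; lia.
case=> [[i _ [j j0 zs]]|[i zs]]; exists i => //.
  exists (j - 1); first by lia.
  by rewrite /advance mem_shift ifF ?subrK //; apply/negbTE/eqP; lia.
by exists 0 => //; rewrite /advance eqxx mem_shift.
Qed.

Lemma advance_endpoints Gam g i :
  endpoints (advance Gam g) i = last (endpoints Gam i) (g i) - up d L.
Proof. by rewrite /endpoints /advance eqxx finish_shift. Qed.

Definition joint_cat g g' : {ffun 'I_k -> seq site} :=
  [ffun i => g i ++ map (+%R^~ (up d L)) (g' i)].

(** The attached paths to level [n + 1] are cut at their first visits to level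
    [1], and what comes afterwards is shifted down. *)
Lemma joint_passages_cat Gam (n : nat) : configuration Gam ->
  set_bij (joint_passages 1 (endpoints Gam) `*``
             (fun g => joint_passages n%:Z (endpoints (advance Gam g))))
    (joint_passages n.+1%:Z (endpoints Gam)) (fun q => joint_cat q.1 q.2).
Proof.
move=> cG; have e0 i := endpoints_level i cG.
have n1 : n.+1%:Z = n%:Z + level (up d L) by rewrite /level /=; lia.
have e1 i : level (endpoints Gam i) <= 1 by rewrite e0.
have n1' : 1 <= n.+1%:Z :> int by lia.
split.
- move=> [g g'] [/= Hg Hg'] i; rewrite ffunE.
  apply: (first_passage_cat (e1 i) n1' (Hg i)).
  rewrite n1 -[last _ _](subrK (up d L)) first_passage_shift.
  by have := Hg' i; rewrite advance_endpoints.
- move=> [g g'] [h h'] /set_mem[/= Hg _] /set_mem[/= Hh _] E.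
  have EE i : g i = h i /\ g' i = h' i.
    move/ffunP/(_ i): E; rewrite !ffunE => E.
    have [-> /inj_map] := first_passage_cat_inj (Hg i) (Hh i) E.
    by move/(_ (addIr _)).
  by congr pair; apply/ffunP => i; have [] := EE i.
- move=> g Hg.
  have H i : exists q : seq site * seq site, [/\ g i = q.1 ++ q.2,
      first_passage 1 (endpoints Gam i) q.1 &
      first_passage n.+1%:Z (last (endpoints Gam i) q.1) q.2].
    have [s1 [s2 [? ? ?]]] := first_passage_split (e1 i) n1' (Hg i).
    by exists (s1, s2).
  have [f Hf] := boolp.choice H.
  pose g1 : {ffun 'I_k -> seq site} := [ffun i => (f i).1].
  pose g2 : {ffun 'I_k -> seq site} := [ffun i => map (+%R^~ (- up d L)) (f i).2].
  exists (g1, g2).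
    split=> i /=; first by rewrite ffunE; have [] := Hf i.
    rewrite advance_endpoints !ffunE; have [_ _] := Hf i.
    rewrite -(first_passage_shift (- up d L)) n1 level_opp_up /=.
    by rewrite (_ : n%:Z + level (up d L) + -1 = n%:Z) // /level /=; lia.
  apply/ffunP => i; rewrite !ffunE /= -map_comp map_id_in => [|z _ /=].
    by have [] := Hf i.
  by rewrite subrK.
Qed.

Lemma extension_sites_cat Gam g g' z : extension_sites Gam (joint_cat g g') z <->
  extension_sites (advance Gam g) g' (z - up d L).
Proof.
have mem_shift y s : (y \in map (+%R^~ (up d L)) s) = (y - up d L \in s).
  by rewrite -{1}(subrK (up d L) y) (mem_map (addIr _)).
rewrite {2}/extension_sites advance_sites0; split.
  case=> [zG|[i]]; first by left; left; rewrite /= subrK.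
  rewrite ffunE -cat_cons mem_cat => /orP[zs|zs].
    by left; right; exists i; rewrite subrK.
  by right; exists i; rewrite inE -mem_shift zs orbT.
case=> [[]|[i]]; rewrite ?subrK.
- by left.
- case=> i zs; right; exists i.
  by rewrite ffunE -cat_cons mem_cat zs.
- rewrite advance_endpoints inE (inj_eq (addIr _)) => /orP[/eqP->|zs].
    by right; exists i; rewrite ffunE -cat_cons mem_cat mem_last.
  right; exists i; rewrite ffunE -cat_cons mem_cat mem_shift zs orbT //.
Qed.

Lemma extension_sites_cat_sub Gam g g' :
  extension_sites Gam g `<=` extension_sites Gam (joint_cat g g').
Proof.
move=> z [zG|[i zs]]; [by left|right; exists i].
by rewrite ffunE -cat_cons mem_cat zs.
Qed.

End Configurations.

(** * Nice configurations *)

(** The counting condition says that infinitely many slices are connected. *)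
Lemma count_unbounded (b : nat -> bool) :
  (forall n, exists2 m, (n < m)%N & (n <= \sum_(1 <= j < m.+1) b j)%N) <->
  (forall m, exists2 j, (m < j)%N & b j).
Proof.
split=> H.
  move=> m; have [m' mm' le] := H m.+1; apply: contrapT => Hn.
  have bF j : (m < j)%N -> b j = false.
    by move=> mj; apply/negbTE/negP => bj; apply: Hn; exists j.
  move: le; rewrite (@big_cat_nat _ _ _ m.+1) //=; last by lia.
  rewrite [X in (_ + X)%N]big_nat_cond [X in (_ + X)%N]big1 ?addn0; last first.
    by move=> j /andP[/andP[mj _] _]; rewrite bF.
  apply/negP; rewrite -ltnNge ltnS.
  apply: (@leq_trans (\sum_(1 <= j < m.+1) 1)%N).
    by apply: leq_sum => j _; case: (b j).
  by rewrite sum_nat_const_nat muln1; lia.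
elim=> [|n [m nm le]]; first by exists 1%N.
have [j mj bj] := H (maxn m n.+1); exists j; first by lia.
rewrite (@big_cat_nat _ _ _ m.+1) //=; last by lia.
have : (1 <= \sum_(m.+1 <= i < j.+1) b i)%N.
  by rewrite big_nat_recr /= ?bj; lia.
by lia.
Qed.

Section NiceConfigurations.
Variables (R : realType) (d L k : nat) (p : R).
Local Notation site := (site d L).
Implicit Types (x y z : site) (Gam : 'I_k -> int -> seq site)
  (g : {ffun 'I_k -> seq site}) (n : nat).
Hypothesis (hd : (1 <= d)%N) (hk : (1 <= k)%N) (hp : 1 / 2 < p < 1).
Variables (disp1 : measure_display) (Om1 : measurableType disp1)
  (P1 : site -> probability Om1 R) (S : nat -> Om1 -> site).
Hypothesis hS : forall x, random_walk p (P1 x) S x.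
Local Notation nice := (@nice R d L disp1 Om1 P1 S k).
Local Notation escape := (escape P1 S).
Local Notation escape_ratio := (escape_ratio P1 S).
Local Notation low_starts := (low_starts P1 S).

Lemma nice1E (gam : int -> seq site) : nice1 gam <->
  far_component 0 (trace0 gam) !=set0 /\ often_connected (trace0 gam).
Proof.
rewrite /nice1 free_componentE; split=> -[Dn H]; split=> //.
  move=> m; have [j mj /asboolP cj] := (count_unbounded _).1 H m.
  by exists j.
apply: (count_unbounded _).2 => m; have [j mj cj] := H m.
by exists j => //; apply/asboolP.
Qed.

Definition Zpath n Gam g : R := Zlim P1 S n (sites0 Gam) (extension_sites Gam g).

(** [nice_limit] with finite paths in place of infinite trajectories: the form in
    which niceness is used, for every [k]. *)
Definition limit_property Gam := reachable P1 S (sites0 Gam) /\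
  forall n g, joint_passages n%:Z (endpoints Gam) g ->
  cvg (escape_ratio n%:Z (sites0 Gam) (extension_sites Gam g) x
         @[x --> low_starts (sites0 Gam)]).

Lemma sites0_extension Gam g : sites0 Gam `<=` extension_sites Gam g.
Proof. by move=> z; left. Qed.

Lemma Zpath_cvg n Gam g : limit_property Gam ->
  joint_passages n%:Z (endpoints Gam) g ->
  escape_ratio n%:Z (sites0 Gam) (extension_sites Gam g) x
    @[x --> low_starts (sites0 Gam)] --> Zpath n Gam g.
Proof.
move=> [rG cG] Hg; have C := cG n g Hg.
by rewrite /Zpath (Zlim_ratio hd hp hS rG (@sites0_extension Gam g) C).
Qed.

Lemma Zfilter_cvgE n A A' : A `<=` A' ->
  cvg (Zfilter P1 S n A A') <-> cvg (escape_ratio n%:Z A A' x @[x --> low_starts A]).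
Proof.
move=> AA'; split=> /cvg_ex[l Hl]; apply/cvg_ex; exists l.
  exact: ((Zfilter_cvg hd hp hS n l AA').1 Hl).
exact: ((Zfilter_cvg hd hp hS n l AA').2 Hl).
Qed.

Lemma nice_limitE Gam : configuration Gam ->
  nice_limit P1 S Gam <-> limit_property Gam.
Proof.
move=> cG; split=> -[rG H]; split=> //.
- move=> n g Hg; apply: (Zfilter_cvgE n (@sites0_extension Gam g)).1.
  pose f i := prolong (endpoints Gam i) (g i).
  have <- : extend Gam n f = extension_sites Gam g.
    by apply: extend_follows Hg _ => i; exact: follows_prolong.
  apply: H => i; split.
  + by rewrite /f; case: (g i).
  + by move=> t; apply: prolong_adj; exact: first_passage_path (Hg i).
  + exists (size (g i)); rewrite /f (follows_last (@follows_prolong _ _ _ _)).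
    exact: first_passage_last (Hg i).
- move=> n f Hf.
  have Hs i : exists s, first_passage n%:Z (endpoints Gam i) s /\
      follows (f i) (endpoints Gam i) s.
    by have [f0 fadj ft] := Hf i; rewrite -f0; exact: trajectory_first_passage.
  have [h Hh] := boolp.choice Hs; pose g : {ffun 'I_k -> seq site} := [ffun i => h i].
  have Hg : joint_passages n%:Z (endpoints Gam) g.
    by move=> i; rewrite ffunE; case: (Hh i).
  have -> : extend Gam n f = extension_sites Gam g.
    by apply: extend_follows Hg _ => i; rewrite ffunE; case: (Hh i).
  exact: (Zfilter_cvgE n (@sites0_extension Gam g)).2 (H n g Hg).
Qed.

Lemma extension_sites_deep n Gam g : configuration Gam ->
  joint_passages n%:Z (endpoints Gam) g ->
  exists j : nat, forall z, level z <= - j%:Z ->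
    sites0 Gam z <-> extension_sites Gam g z.
Proof.
move=> cG Hg.
have [j Hj] := joint_sites_deep (fun i => endpoints_level i cG) Hg.
exists j => z zj; split; first by left.
by case=> // /Hj; rewrite ltNge zj.
Qed.

(** For [k = 1] this is the convergence theorem for a path with infinitely many
    connected slices. *)
Lemma nice_limit_property Gam : nice Gam -> limit_property Gam.
Proof.
case=> cG; case: ifP => [k1 HG|_ /nice_limitE]; last exact.
have i0 : 'I_k := Ordinal hk.
have [Dn oc] := (nice1E (Gam i0)).1 (HG i0).
rewrite -(sites0_one Gam k1 i0) in Dn oc; split.
  exact: (far_component_reachable hd hp hS).
move=> n g Hg; have [j Hj] := extension_sites_deep cG Hg.
exact: (ratio_cvg hd hp hS Dn oc (@sites0_extension Gam g) Hj).
Qed.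

End NiceConfigurations.

(** * Extending a configuration by one level *)

Section ComponentExtension.
Variables (d L : nat).
Local Notation site := (site d L).
Implicit Types (x y z w a : site) (A : set site) (r : int).

(** Cut the path to level [r'] at its first visit to level [r]. *)
Lemma connected_in_lower r r' A A' z w : A `<=` A' -> level z <= r -> r <= r' ->
  level w = r' -> connected_in (free_below r' A') z w ->
  exists2 v, level v = r & connected_in (free_below r A) z v.
Proof.
move=> AA' zr rr' wr [s [ps ls Hs]].
have [|s1 [s2 [E rs]]] := path_first_passage ps zr; first by rewrite ls wr.
exists (last z s1); first exact: first_passage_last rs.
apply: free_passages_connected => //; split=> // v vs /AA'.
by have [] := Hs v; rewrite // E -cat_cons mem_cat vs.
Qed.

Lemma connected_in_shift a r A x y : connected_in (free_below r A) x y ->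
  connected_in (free_below (r + level a) [set z | A (z - a)]) (x + a) (y + a).
Proof.
move=> [s [ps ls Hs]]; exists (map (+%R^~ a) s); split.
- elim: s x ps {ls Hs} => //= v s IH x /andP[xv vs].
  by rewrite adj_shift xv IH.
- by rewrite (last_map (+%R^~ a)) ls.
- move=> v; rewrite -(map_cons (+%R^~ a)) => /mapP[u /Hs[ur nA] ->].
  have ur' : level (u + a) <= r + level a by rewrite levelD lerD2r.
  by split=> //=; rewrite addrK.
Qed.

Lemma far_component_shift a r A z : far_component r A z ->
  far_component (r + level a) [set z | A (z - a)] (z + a).
Proof.
move=> [[w wr zw] H]; split.
  by exists (w + a); [rewrite levelD wr|exact: connected_in_shift].
move=> m; have [v vm zv] := H (m + `|level a|)%N.
by exists (v + a); [rewrite levelD; lia|exact: connected_in_shift].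
Qed.

Lemma far_component_shiftE A :
  far_component 0 [set z | A (z + up d L)]
  = [set z | far_component 1 A (z + up d L)].
Proof.
have up1 : level (up d L) = 1 by [].
apply/seteqP; split=> z /=.
  move/(far_component_shift (up d L)); rewrite up1 add0r.
  rewrite (_ : [set _ | _] = A) //; apply/seteqP; split=> v /=; rewrite subrK //.
move/(far_component_shift (- up d L)); rewrite level_opp_up subrr addrK.
by rewrite (_ : [set _ | _] = [set z | A (z + up d L)]) //;
  apply/seteqP; split=> v /=; rewrite opprK.
Qed.

(** Far below, adding to [A] a set bounded below changes no connected slice:
    such a slice is met by the new component, which spreads over it. *)
Lemma often_connected_extend A A' (j : nat) : A `<=` A' ->
  (forall z, level z <= - j%:Z -> A z <-> A' z) ->
  often_connected A -> far_component 1 A' !=set0 ->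
  forall m : nat, exists2 i : nat, (m < i)%N &
    graph_connected (slice (far_component 1 A') (- i%:Z)).
Proof.
move=> AA' deep oc Dn m; have [M HM] := far_component_deep 0 A.
have [i mi conn] := oc (maxn m (maxn j M)); exists i; first by lia.
have sub z : far_component 1 A' z -> level z = - i%:Z -> far_component 0 A z.
  move=> [[w w1 zw] _] zi.
  have [||v v0 zv] := connected_in_lower AA' (_ : level z <= 0) _ w1 zw.
  - by rewrite zi; lia.
  - by [].
  - by apply: (HM z v _ v0 zv); rewrite zi; lia.
have i1 : - i%:Z <= 1 by lia.
have [u Du ui] := far_component_levels Dn i1.
suff -> : slice (far_component 1 A') (- i%:Z) = slice (far_component 0 A) (- i%:Z).
  by [].
apply/seteqP; split=> z [Dz /= zi]; split=> //; first exact: sub.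
have C := conn u z (conj (sub u Du ui) ui) (conj Dz zi).
apply: (far_component_connected Du); apply: connected_in_sub C => v [Dv /= vi].
have [_ nA] := far_component_free_below Dv.
split=> /=; first by rewrite vi.
by move/(deep v _).2; rewrite vi => /(_ _)/nA; apply; lia.
Qed.

End ComponentExtension.

Lemma filter_cvg_le (R : realType) (T : Type) (F : set_system T)
    (PF : ProperFilter F) (f g : T -> R) (a b : R) :
  f x @[x --> F] --> a -> g x @[x --> F] --> b ->
  (\forall x \near F, f x <= g x) -> a <= b.
Proof.
move=> fa gb fg; rewrite -subr_ge0.
have C : g x - f x @[x --> F] --> b - a by exact: cvgB.
rewrite -(cvg_lim (@norm_hausdorff _ _) C); apply: limr_ge; first by apply/cvg_ex; exists (b - a).
by near=> x; rewrite subr_ge0; near: x.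
Unshelve. all: by end_near. Qed.

Section Gluing.
Variables (R : realType) (d L k : nat) (p : R).
Local Notation site := (site d L).
Implicit Types (x y z : site) (Gam : 'I_k -> int -> seq site)
  (g : {ffun 'I_k -> seq site}) (n : nat).
Hypothesis (hd : (1 <= d)%N) (hp : 1 / 2 < p < 1).
Variables (disp1 : measure_display) (Om1 : measurableType disp1)
  (P1 : site -> probability Om1 R) (S : nat -> Om1 -> site).
Hypothesis hS : forall x, random_walk p (P1 x) S x.
Local Notation nice := (@nice R d L disp1 Om1 P1 S k).
Local Notation escape := (escape P1 S).
Local Notation escape_ratio := (escape_ratio P1 S).
Local Notation low_starts := (low_starts P1 S).
Local Notation limit_property := (@limit_property R d L k disp1 Om1 P1 S).
Local Notation Zpath := (@Zpath R d L k disp1 Om1 P1 S).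

Lemma escape_up n A x : level x <= n%:Z ->
  escape n%:Z [set z | A (z + up d L)] x = escape n.+1%:Z A (x + up d L).
Proof.
move=> xn; have up1 : level (up d L) = 1 by [].
have -> : n.+1%:Z = n%:Z + 1 by lia.
rewrite -(escape_shift hd hp hS (up d L)) // up1.
by congr (escape _ _ _); apply/seteqP; split=> z /=; rewrite subrK.
Qed.

Lemma escape_ratio_ge0 n A A' x : 0 <= escape_ratio n%:Z A A' x.
Proof. by rewrite divr_ge0 // escape_ge0. Qed.

Lemma escape_ratio_anti n A A' A'' : A' `<=` A'' ->
  \forall x \near low_starts A,
    escape_ratio n.+1%:Z A A'' x <= escape_ratio 1 A A' x.
Proof.
move=> AA; have nl := near_low hS A 0; near=> x.
have [x0 e0] : level x <= - 0%:Z /\ 0 < escape 0 A x by near: x.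
rewrite ler_pM2r ?invr_gt0 //; apply: (escape_anti hd hp hS) => //.
by apply: le_trans x0 _.
Unshelve. all: by end_near. Qed.

Lemma Zpath_ge0 n Gam g : limit_property Gam ->
  joint_passages n%:Z (endpoints Gam) g -> 0 <= Zpath n Gam g.
Proof.
move=> lG Hg; have PF := low_proper lG.1.
apply: (filter_cvg_le PF (cvg_cst 0) (Zpath_cvg hd hp hS lG Hg)).
by near=> x; exact: escape_ratio_ge0.
Unshelve. all: by end_near. Qed.

Lemma Zpath_le1 n Gam g : limit_property Gam ->
  joint_passages n%:Z (endpoints Gam) g -> Zpath n Gam g <= 1.
Proof.
move=> lG Hg; have PF := low_proper lG.1.
have C1 : (fun=> 1 : R) x @[x --> low_starts (sites0 Gam)] --> (1 : R).
  exact: cvg_cst.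
apply: (filter_cvg_le PF (Zpath_cvg hd hp hS lG Hg) C1).
have nl := near_low hS (sites0 Gam) 0; near=> x.
have [x0 e0] : level x <= - 0%:Z /\ 0 < escape 0 (sites0 Gam) x by near: x.
rewrite ler_pdivrMr // mul1r; apply: (escape_anti hd hp hS) => //.
exact: sites0_extension.
Unshelve. all: by end_near. Qed.

(** Any start that can avoid [A'] up to level [1] can avoid [A] up to level [0]. *)
Lemma shift_low_starts A A' : A `<=` A' ->
  x + up d L @[x --> low_starts [set z | A' (z + up d L)]] --> low_starts A.
Proof.
move=> AA' Q [m _ HQ]; exists m.+1 => // x /= xm.
have xm' : level (x + up d L) <= - m%:Z by rewrite levelD /level /=; move: xm; rewrite /level; lia.
have x0 : level x <= 0 by lia.
have x0' : level (x + up d L) <= 0 by lia.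
rewrite /admissible /= -(escape_EFin hS) lte_fin (escape_up A') // => e.
apply: (HQ _ xm'); rewrite /admissible /= -(escape_EFin hS) lte_fin.
by apply: lt_le_trans e _; apply: (escape_anti hd hp hS).
Qed.

(** Since [Z_1 > 0], low starts that can avoid the paths up to level [0] can avoid
    them up to level [1]. *)
Lemma advance_reachable Gam g : limit_property Gam ->
  joint_passages 1 (endpoints Gam) g -> 0 < Zpath 1 Gam g ->
  reachable P1 S (sites0 (advance Gam g)).
Proof.
move=> lG Hg Z0; have PF := low_proper lG.1.
apply/(reachableP hS) => m; rewrite advance_sites0.
have H1 : \forall x \near low_starts (sites0 Gam), 0 <
    escape_ratio 1 (sites0 Gam) (extension_sites Gam g) x.
  exact: cvgr_gt _ (Zpath_cvg hd hp hS lG Hg) _ Z0.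
have H2 := near_low hS (sites0 Gam) m.
have [x [[xm e0] r0]] := filter_ex (filterI H2 H1).
exists (x - up d L); first by rewrite levelD level_opp_up; lia.
rewrite (escape_up (extension_sites Gam g)); last by rewrite levelD level_opp_up; lia.
by rewrite subrK; move: r0; rewrite pmulr_lgt0 // invr_gt0.
Qed.

(** Conditioning in two stages: the chance of avoiding the paths up to level
    [n + 1] is the chance of avoiding them up to level [1] times the
    conditional chance of going on, which is seen from level [1]. *)
Lemma advance_cvg n Gam g g' : limit_property Gam ->
  joint_passages 1 (endpoints Gam) g -> 0 < Zpath 1 Gam g ->
  joint_passages n.+1%:Z (endpoints Gam) (joint_cat g g') ->
  escape_ratio n%:Z (sites0 (advance Gam g)) (extension_sites (advance Gam g) g') x
    @[x --> low_starts (sites0 (advance Gam g))]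
  --> Zpath n.+1 Gam (joint_cat g g') / Zpath 1 Gam g.
Proof.
move=> lG Hg Z0 Hgg; have C1 := Zpath_cvg hd hp hS lG Hg.
have C2 := Zpath_cvg hd hp hS lG Hgg.
set A := sites0 Gam in C1 C2; set A1 := extension_sites Gam g in C1.
set A2 := extension_sites Gam (joint_cat g g') in C2.
pose G y := escape_ratio n.+1%:Z A A2 y / escape_ratio 1 A A1 y.
have C : G x @[x --> low_starts A] -->
    Zpath n.+1 Gam (joint_cat g g') / Zpath 1 Gam g.
  by apply: cvgM C2 _; apply: cvgV C1; exact: lt0r_neq0.
have sub : A `<=` A1 := @sites0_extension _ _ _ Gam g.
have E0 : sites0 (advance Gam g) = [set z | A1 (z + up d L)] := advance_sites0 Gam g.
have E2 : extension_sites (advance Gam g) g' = [set z | A2 (z + up d L)].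
  apply/seteqP; split=> z /=.
    by move=> H; apply/extension_sites_cat; rewrite addrK.
  by move/extension_sites_cat; rewrite addrK.
rewrite E2 E0; have F := @cvg_comp _ _ _ (fun x => x + up d L) G _ _ _ (shift_low_starts sub) C.
apply: cvg_trans F; apply: near_eq_cvg.
have nl := near_low hS [set z | A1 (z + up d L)] 1; near=> x.
have [x1 e0] : level x <= - 1%N%:Z /\ 0 < escape 0 [set z | A1 (z + up d L)] x by near: x.
have x0 : level x <= 0 by lia.
have x0' : level (x + up d L) <= 0 by rewrite levelD; move: x1; rewrite /level /=; lia.
have e1 : 0 < escape 1 A1 (x + up d L) by rewrite -(@escape_up 0).
have e2 : 0 < escape 0 A (x + up d L).
  by apply: lt_le_trans e1 _; apply: (escape_anti hd hp hS).
rewrite /= /G !escape_ratioE (@escape_up 0 A1) // (@escape_up n A2); last by lia.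
by field; rewrite !gt_eqF.
Unshelve. all: by end_near. Qed.

End Gluing.

Section Advance.
Variables (R : realType) (d L k : nat) (p : R).
Local Notation site := (site d L).
Implicit Types (x y z : site) (Gam : 'I_k -> int -> seq site)
  (g : {ffun 'I_k -> seq site}) (n : nat).
Hypothesis (hd : (1 <= d)%N) (hk : (1 <= k)%N) (hp : 1 / 2 < p < 1).
Variables (disp1 : measure_display) (Om1 : measurableType disp1)
  (P1 : site -> probability Om1 R) (S : nat -> Om1 -> site).
Hypothesis hS : forall x, random_walk p (P1 x) S x.
Local Notation nice := (@nice R d L disp1 Om1 P1 S k).
Local Notation limit_property := (@limit_property R d L k disp1 Om1 P1 S).
Local Notation Zpath := (@Zpath R d L k disp1 Om1 P1 S).

Lemma joint_passages_joint_cat n Gam g g' : configuration Gam ->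
  joint_passages 1 (endpoints Gam) g ->
  joint_passages n%:Z (endpoints (advance Gam g)) g' ->
  joint_passages n.+1%:Z (endpoints Gam) (joint_cat g g').
Proof.
by move=> cG Hg Hg'; have [H _ _] := joint_passages_cat n cG; exact: (H (g, g')).
Qed.

Lemma advance_limit_property Gam g : configuration Gam -> limit_property Gam ->
  joint_passages 1 (endpoints Gam) g -> 0 < Zpath 1 Gam g ->
  limit_property (advance Gam g).
Proof.
move=> cG lG Hg Z0; split; first exact: (advance_reachable hd hp hS lG Hg Z0).
move=> n g' Hg'; apply/cvg_ex; eexists.
apply: (advance_cvg hd hp hS lG Hg Z0).
exact: joint_passages_joint_cat.
Qed.

(** The limits for the new configuration are quotients by [Z_1] of limits for the
    old one; for [k = 1] the component is unbounded by [advance_reachable] and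
    inherits the connected slices far down. *)
Lemma advance_nice Gam g : nice Gam ->
  joint_passages 1 (endpoints Gam) g -> 0 < Zpath 1 Gam g ->
  nice (advance Gam g).
Proof.
move=> nG Hg Z0; have lG := nice_limit_property hd hk hp hS nG.
have [cG HG] := nG; have cA := advance_configuration cG Hg.
have lA := advance_limit_property cG lG Hg Z0.
split=> //; move: HG; case: ifP => [k1 HG i|_ _]; last first.
  exact: ((nice_limitE hd hp hS cA).2 lA).
have [_ oc] := (nice1E (Gam i)).1 (HG i).
apply/nice1E; rewrite -(sites0_one _ k1 i) in oc; rewrite -(sites0_one _ k1 i).
have [j Hj] := @extension_sites_deep d L k 1 Gam g cG Hg.
have Dn : far_component 0 (sites0 (advance Gam g)) !=set0.
  have [M HM] := far_component_deep 0 (sites0 (advance Gam g)).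
  have [x xM e0] := (reachableP hS _).1 lA.1 M; exists x.
  have x0 : level x <= 0 by lia.
  have [w w0 xw] := (escape_gt0_connected hd hp hS _ x0).1 e0.
  exact: HM xM w0 xw.
split=> //.
have E : far_component 0 (sites0 (advance Gam g)) =
    [set z | far_component 1 (extension_sites Gam g) (z + up d L)].
  by rewrite advance_sites0 far_component_shiftE.
have Dn1 : far_component 1 (extension_sites Gam g) !=set0.
  by case: Dn => x; rewrite E; exists (x + up d L).
move=> m.
have [i' mi conn] := often_connected_extend (@sites0_extension _ _ _ Gam g) Hj oc Dn1 m.
exists i'.+1; first by lia.
move=> x y [Dx /= xi] [Dy /= yi]; rewrite E /= in Dx Dy.
have xi' : level (x + up d L) = - i'%:Z by rewrite levelD xi /level /=; lia.
have yi' : level (y + up d L) = - i'%:Z by rewrite levelD yi /level /=; lia.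
have [s [ps ls Hs]] := conn _ _ (conj Dx xi') (conj Dy yi').
exists (map (+%R^~ (- up d L)) s); split.
- rewrite -{1}(addrK (up d L) x); elim: s (x + up d L) ps {ls Hs} => //= v s IH u.
  by case/andP => uv vs; rewrite adj_shift uv IH.
- by rewrite -{1}(addrK (up d L) x) (last_map (+%R^~ (- up d L))) ls addrK.
- move=> v; rewrite -{1}(addrK (up d L) x) -(map_cons (+%R^~ (- up d L))).
  case/mapP => u /Hs[Du /= ui] ->; split; first by rewrite E /= subrK.
  by change (level (u - up d L) = - i'.+1%:Z); rewrite levelD ui level_opp_up; lia.
Qed.

(** If [Z_1 = 0], both sides vanish because avoiding more paths is harder. *)
Lemma Zpath_cat n Gam g g' : configuration Gam -> limit_property Gam ->
  joint_passages 1 (endpoints Gam) g ->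
  joint_passages n%:Z (endpoints (advance Gam g)) g' ->
  Zpath n.+1 Gam (joint_cat g g') = Zpath 1 Gam g * Zpath n (advance Gam g) g'.
Proof.
move=> cG lG Hg Hg'; have Hgg := joint_passages_joint_cat cG Hg Hg'.
have PF := low_proper lG.1.
have := Zpath_ge0 hd hp hS lG Hg; rewrite le_eqVlt => /orP[/eqP Z0|Z0].
  rewrite -Z0 mul0r; apply/eqP; rewrite eq_le (Zpath_ge0 hd hp hS) // andbT Z0.
  apply: (filter_cvg_le PF (Zpath_cvg hd hp hS lG Hgg) (Zpath_cvg hd hp hS lG Hg)).
  by apply: (escape_ratio_anti hd hp hS); exact: extension_sites_cat_sub.
have lA := advance_limit_property cG lG Hg Z0.
have C := advance_cvg hd hp hS lG Hg Z0 Hgg.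
have -> : Zpath n (advance Gam g) g' = Zpath n.+1 Gam (joint_cat g g') / Zpath 1 Gam g.
  exact: (Zlim_ratio hd hp hS lA.1 (@sites0_extension _ _ _ _ _) C).
by rewrite mulrCA divff ?mulr1 // gt_eqF.
Qed.

End Advance.

(** * Moments of Z and the lower bound *)

Section Moments.
Variables (R : realType) (d L k : nat) (p lam : R).
Local Notation site := (site d L).
Implicit Types (x y z : site) (Gam : 'I_k -> int -> seq site)
  (g : {ffun 'I_k -> seq site}) (n m : nat).
Hypothesis (hd : (1 <= d)%N) (hk : (1 <= k)%N) (hp : 1 / 2 < p < 1)
  (hlam : 0 < lam).
Variables (disp1 : measure_display) (Om1 : measurableType disp1)
  (P1 : site -> probability Om1 R) (S : nat -> Om1 -> site).
Hypothesis hS : forall x, random_walk p (P1 x) S x.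
Variables (disp : measure_display) (Om : measurableType disp)
  (P : ('I_k -> site) -> probability Om R) (W : 'I_k -> nat -> Om -> site).
Hypothesis hW : forall e, independent_walks p (P e) W e.
Local Notation nice := (@nice R d L disp1 Om1 P1 S k).
Local Notation Zpath := (@Zpath R d L k disp1 Om1 P1 S).
Local Notation EZ := (EZ P1 S P W lam).
Local Notation q := (q P1 S P W lam).
Local Open Scope ereal_scope.

Lemma joint_weight_ge0 (e : 'I_k -> site) g : (0 <= joint_weight p e g)%R.
Proof. by apply: prodr_ge0 => i _; exact: weight_ge0 hd hp _ _. Qed.

(** Outside a null set the walks reach level [n] and the integrand is a function
    of the stopped paths. *)
Lemma EZ_path_sum n Gam : configuration Gam ->
  EZ n Gam = \esum_(g in joint_passages n%:Z (endpoints Gam))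
    (joint_weight p (endpoints Gam) g * Zpath n Gam g `^ lam)%:E.
Proof.
move=> cG; rewrite /EZ unlock; set e := endpoints Gam.
have en i : (level (e i) <= n%:Z)%R by rewrite endpoints_level.
rewrite (@integral_countable_partition _ _ _ (P e) _
  (joint_passages n%:Z e) (joint_event W e) _ (fun g => (Zpath n Gam g `^ lam)%:E)).
- apply: eq_esum => g _.
  by rewrite (joint_event_prob (hW e)) -EFinM mulrC.
- exact: joint_event_measurable (hW e).
- exact: joint_passages_trivIset.
- exact: (joint_passages_as hd hp (hW e) en).
- by move=> w; rewrite lee_fin powR_ge0.
- by move=> g Hg w Hw; rewrite (extend_follows Hg Hw).
Qed.

Lemma joint_weight_sum1 n (e : 'I_k -> site) : (forall i, level (e i) = 0%R) ->
  \esum_(g in joint_passages n%:Z e) (joint_weight p e g)%:E = 1.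
Proof.
move=> e0; have en i : (level (e i) <= n%:Z)%R by rewrite e0.
rewrite -(joint_passages_as hd hp (hW e) en) measure_bigcup_esum.
- by apply: eq_esum => g _; rewrite (joint_event_prob (hW e)).
- by move=> g _; exact: joint_event_measurable (hW e) g.
- exact: joint_passages_trivIset.
Qed.

Lemma EZ_ge0 n Gam : configuration Gam -> 0 <= EZ n Gam.
Proof.
move=> cG; rewrite EZ_path_sum //; apply: esum_ge0 => g _.
by rewrite lee_fin mulr_ge0 ?joint_weight_ge0 ?powR_ge0.
Qed.

Lemma EZ_le1 n Gam : nice Gam -> EZ n Gam <= 1.
Proof.
move=> nG; have lG := nice_limit_property hd hk hp hS nG; have cG := nG.1.
rewrite EZ_path_sum // -(joint_weight_sum1 n (fun i => endpoints_level i cG)).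
apply: le_esum => g Hg; rewrite lee_fin ler_piMr ?joint_weight_ge0 //.
have Z0 := Zpath_ge0 hd hp hS lG Hg; have Z1 := Zpath_le1 hd hp hS lG Hg.
have E1 : (1 `^ lam = 1 :> R)%R by rewrite powR1.
by rewrite -E1; apply: ge0_ler_powR; rewrite ?nnegrE ?(ltW hlam).
Qed.

Lemma joint_weight_cat Gam g g' : joint_weight p (endpoints Gam) (joint_cat g g')
  = (joint_weight p (endpoints Gam) g *
     joint_weight p (endpoints (advance Gam g)) g')%R.
Proof.
rewrite /joint_weight -big_split; apply: eq_bigr => i _ /=.
rewrite ffunE weight_cat advance_endpoints; congr (_ * _)%R.
by rewrite -[in LHS](subrK (up d L) (last _ _)) weight_shift.
Qed.

(** The Markov property of the attached walks at level [1]. *)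
Lemma EZ_advance n Gam : nice Gam ->
  EZ n.+1 Gam = \esum_(g in joint_passages 1 (endpoints Gam))
    ((joint_weight p (endpoints Gam) g * Zpath 1 Gam g `^ lam)%:E
      * EZ n (advance Gam g)).
Proof.
move=> nG; have lG := nice_limit_property hd hk hp hS nG; have cG := nG.1.
rewrite EZ_path_sum // (reindex_esum _ _ _ _ (joint_passages_cat n cG)).
rewrite -(@esum_esum _ _ _ _ (fun g => joint_passages n%:Z (endpoints (advance Gam g)))
   (fun g g' => (joint_weight p (endpoints Gam) (joint_cat g g')
       * Zpath n.+1 Gam (joint_cat g g') `^ lam)%:E)); last first.
  by move=> *; rewrite lee_fin mulr_ge0 ?joint_weight_ge0 ?powR_ge0.
apply: eq_esum => g Hg; rewrite EZ_path_sum; last exact: advance_configuration.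
rewrite -esumZl; last 2 first.
- by rewrite mulr_ge0 ?joint_weight_ge0 ?powR_ge0.
- by move=> g'; rewrite lee_fin mulr_ge0 ?joint_weight_ge0 ?powR_ge0.
apply: eq_esum => g' Hg'; rewrite -EFinM; congr (_%:E).
rewrite joint_weight_cat (Zpath_cat hd hp hS cG lG Hg Hg').
have Z0 := Zpath_ge0 hd hp hS lG Hg; move: (Z0); rewrite le_eqVlt => /orP[/eqP <-|Z1].
  by rewrite mul0r powR0 ?gt_eqF // !mulr0 mul0r.
have lA := advance_limit_property hd hp hS cG lG Hg Z1.
by rewrite powRM ?(Zpath_ge0 hd hp hS lA Hg') // mulrACA.
Qed.

Lemma q_ge0 n : (exists Gam, nice Gam) -> 0 <= q n.
Proof.
move=> [Gam nG]; apply: le_trans (EZ_ge0 n nG.1) _.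
by apply: ereal_sup_ubound; exists Gam.
Qed.

Lemma EZ_le_q n Gam : nice Gam -> EZ n Gam <= q n.
Proof. by move=> nG; apply: ereal_sup_ubound; exists Gam. Qed.

Lemma q_le1 n : q n <= 1.
Proof. by apply: ge_ereal_sup => _ [Gam nG <-]; exact: EZ_le1. Qed.

(** Where the factor [Z_1] vanishes the configuration seen from level [1] need
    not be nice, but then the term is zero. *)
Lemma le_EZ_advance (n : nat) Gam (F : {ffun 'I_k -> seq site} -> \bar R) :
  nice Gam -> (forall g, joint_passages 1 (endpoints Gam) g ->
    nice (advance Gam g) -> EZ n (advance Gam g) <= F g) ->
  EZ n.+1 Gam <= \esum_(g in joint_passages 1 (endpoints Gam))
    ((joint_weight p (endpoints Gam) g * Zpath 1 Gam g `^ lam)%:E * F g).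
Proof.
move=> nG HF; have lG := nice_limit_property hd hk hp hS nG.
rewrite EZ_advance //; apply: le_esum => g Hg.
have := Zpath_ge0 hd hp hS lG Hg; rewrite le_eqVlt => /orP[/eqP <-|Z1].
  by rewrite powR0 ?gt_eqF // mulr0 !mul0e.
apply: lee_wpmul2l; first by rewrite lee_fin mulr_ge0 ?joint_weight_ge0 ?powR_ge0.
by apply: HF => //; exact: (advance_nice hd hk hp hS nG Hg Z1).
Qed.

(** Level by level: the configuration seen from level [n + 1] is still nice, so
    what the [m] remaining levels contribute is at most [q m]. *)
Lemma EZ_submultiplicative n m Gam : nice Gam ->
  EZ (n.+1 + m) Gam <= EZ n.+1 Gam * q m.
Proof.
have fq : nice Gam -> exists2 r : R, (0 <= r)%R & q m = r%:E.
  move=> nG; have q0 : 0 <= q m by apply: q_ge0; exists Gam.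
  exists (fine (q m)); first exact: fine_ge0.
  rewrite fineK // ge0_fin_numE //; exact: le_lt_trans (q_le1 m) (ltry _).
move=> nG; have [r r0 qr] := fq nG; elim: n Gam nG {fq} => [|n IH] Gam nG.
  rewrite add1n; apply: le_trans (le_EZ_advance (F := fun=> q m) nG _) _.
    by move=> g _ nA; exact: EZ_le_q.
  rewrite EZ_path_sum; last exact: nG.1.
  rewrite muleC qr -esumZl // => [|g]; last first.
    by rewrite lee_fin mulr_ge0 ?joint_weight_ge0 ?powR_ge0.
  by apply: le_esum => g _; rewrite muleC.
rewrite addSn.
apply: le_trans (le_EZ_advance
  (F := fun g => r%:E * EZ n.+1 (advance Gam g)) nG _) _.
  by move=> g Hg nA; rewrite muleC -qr; exact: IH.
rewrite EZ_advance // muleC qr -esumZl // => [|g]; last first.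
  rewrite mule_ge0 //.
    by rewrite lee_fin mulr_ge0 ?joint_weight_ge0 ?powR_ge0.
  rewrite /Defs.EZ unlock; apply: integral_ge0 => w _.
  by rewrite lee_fin powR_ge0.
by apply: le_esum => g _; rewrite muleCA.
Qed.

Lemma q_submultiplicative n m : q (n.+1 + m) <= q n.+1 * q m.
Proof.
apply: ge_ereal_sup => _ [Gam nG <-].
apply: le_trans (EZ_submultiplicative n m nG) _.
by apply: lee_wpmul2r; [apply: q_ge0; exists Gam|exact: EZ_le_q].
Qed.

(** The path that goes straight up from each endpoint. *)
Definition straight Gam : {ffun 'I_k -> seq site} :=
  [ffun i => [:: (endpoints Gam i + up d L)%R]].

Lemma straight_passages Gam : configuration Gam ->
  joint_passages 1 (endpoints Gam) (straight Gam).
Proof.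
move=> cG i; rewrite ffunE first_passage_cons first_passage_nil levelD.
rewrite !endpoints_level // eqxx andbT /=.
by apply/adjP; exists (inl true).
Qed.

Lemma straight_weight_ge Gam : configuration Gam ->
  (ellipticity d p ^+ k <= joint_weight p (endpoints Gam) (straight Gam))%R.
Proof.
move=> cG; rewrite /joint_weight.
have -> : (ellipticity d p ^+ k = \prod_(i < k) ellipticity d p)%R.
  by rewrite prodr_const card_ord.
have el0 := ellipticity_gt0 hd hp.
apply: ler_prod => i _; rewrite ltW //=.
have := weight_ge_ellipticity hd hp (first_passage_path (straight_passages cG i)).
by rewrite {1}ffunE expr1.
Qed.

(** A walk that reaches level [0] off the paths can also go straight up. *)
Lemma straight_Zpath_ge Gam : nice Gam ->
  (ellipticity d p <= Zpath 1 Gam (straight Gam))%R.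
Proof.
move=> nG; have lG := nice_limit_property hd hk hp hS nG; have cG := nG.1.
have PF := low_proper lG.1; have Hs := straight_passages cG.
have C1 : (fun=> ellipticity d p) x @[x --> low_starts P1 S (sites0 Gam)]
   --> ellipticity d p by exact: cvg_cst.
apply: (filter_cvg_le PF C1 (Zpath_cvg hd hp hS lG Hs)).
have nl := near_low hS (sites0 Gam) 0; near=> x.
have [x0 e0] : (level x <= - 0%:Z)%R /\ (0 < escape P1 S 0 (sites0 Gam) x)%R by near: x.
rewrite oppr0 in x0; have el0 := ellipticity_gt0 hd hp.
rewrite ler_pdivlMr // -lee_fin EFinM (escapeE hd hp hS) // -(passageZ hd hp) ?(ltW el0) //.
rewrite (escape_markov hd hp hS _ x0) //.
rewrite (passage_local _ (A' := sites0 Gam)) // => [|z z0]; last first.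
  split; last by left.
  case=> // -[i]; rewrite ffunE inE => /orP[/eqP->|].
    exact: endpoints_sites0.
  rewrite inE => /eqP zE; move: z0; rewrite zE levelD endpoints_level //.
apply: le_esum => s fs; have [rs Hfs] := fs.
rewrite lee_fin ler_wpM2l ?(weight_ge0 hd hp) // mulr1.
set y := last x s; have y0 : level y = 0%R := first_passage_last rs.
have adjy : path (@adj d L) y [:: (y + up d L)%R].
  by rewrite /= andbT; apply/adjP; exists (inl true).
have nA z : z = y \/ z = (y + up d L)%R -> ~ extension_sites Gam (straight Gam) z.
  have ny : ~ sites0 Gam y by apply: Hfs; rewrite mem_last.
  move=> zE [zG|[i]].
    case: zE => zE; rewrite zE // in zG.
    by have := sites0_level cG zG; rewrite levelD y0.
  rewrite ffunE !inE => /orP[/eqP ze|/eqP ze].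
    case: zE => zE; first by apply: ny; rewrite -zE ze; exact: endpoints_sites0.
    by have := endpoints_level i cG; rewrite -ze zE levelD y0.
  case: zE => zE.
    by have := y0; rewrite -zE ze levelD endpoints_level.
  apply: ny; rewrite -(addrK (up d L) y) -zE ze addrK; exact: endpoints_sites0.
rewrite -lee_fin (escapeE hd hp hS); last by rewrite y0.
apply: le_trans (_ : (weight p y [:: (y + up d L)%R] * 1)%:E <= _).
  by rewrite lee_fin mulr1 -[X in (X <= _)%R]expr1 (weight_ge_ellipticity hd hp adjy).
apply: (@esum_ge_term _ _ _ (fun s => (weight p y s * 1)%:E)); last first.
  by rewrite lee_fin mulr1 (weight_ge0 hd hp).
split.
  rewrite first_passage_cons first_passage_nil levelD y0 eqxx andbT /=.
  by apply/adjP; exists (inl true).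
by move=> z; rewrite !inE => /orP[/eqP|/eqP] zE; apply: nA; [left|right].
Unshelve. all: by end_near. Qed.

(** A lower bound for the contribution of one more level when all walks go straight
    up. *)
Definition one_level_bound : R := (ellipticity d p ^+ k * ellipticity d p `^ lam)%R.

Lemma one_level_bound_gt0 : (0 < one_level_bound)%R.
Proof.
have el0 := ellipticity_gt0 hd hp.
by rewrite mulr_gt0 ?exprn_gt0 ?powR_gt0.
Qed.

Lemma straight_term_ge Gam : nice Gam ->
  (one_level_bound <= joint_weight p (endpoints Gam) (straight Gam)
      * Zpath 1 Gam (straight Gam) `^ lam)%R.
Proof.
move=> nG; have el0 := ellipticity_gt0 hd hp.
have Zg := straight_Zpath_ge nG.
apply: ler_pM; [by rewrite exprn_ge0 // ltW|exact: powR_ge0|exact: straight_weight_ge nG.1|].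
by apply: ge0_ler_powR; rewrite ?nnegrE ?(ltW el0) ?(ltW hlam) // (le_trans (ltW el0)).
Qed.

Lemma EZ_ge n Gam : nice Gam -> (one_level_bound ^+ n.+1)%:E <= EZ n.+1 Gam.
Proof.
have g0 := one_level_bound_gt0; elim: n Gam => [|n IH] Gam nG; have cG := nG.1.
  rewrite expr1 EZ_path_sum //.
  apply: le_trans (_ : (joint_weight p (endpoints Gam) (straight Gam)
      * Zpath 1 Gam (straight Gam) `^ lam)%:E <= _).
    by rewrite lee_fin straight_term_ge.
  apply: (@esum_ge_term _ _ _ (fun g =>
    (joint_weight p (endpoints Gam) g * Zpath 1 Gam g `^ lam)%:E)).
    exact: straight_passages.
  by rewrite lee_fin mulr_ge0 ?joint_weight_ge0 ?powR_ge0.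
have Zg := lt_le_trans (ellipticity_gt0 hd hp) (straight_Zpath_ge nG).
have nA := advance_nice hd hk hp hS nG (straight_passages cG) Zg.
rewrite EZ_advance // exprS EFinM.
apply: le_trans (_ : (joint_weight p (endpoints Gam) (straight Gam)
      * Zpath 1 Gam (straight Gam) `^ lam)%:E * EZ n.+1 (advance Gam (straight Gam)) <= _).
  apply: lee_pmul; rewrite ?lee_fin ?exprn_ge0 ?(ltW g0) ?straight_term_ge //.
  exact: IH.
apply: (@esum_ge_term _ _ _ (fun g =>
    (joint_weight p (endpoints Gam) g * Zpath 1 Gam g `^ lam)%:E * EZ n.+1 (advance Gam g))).
  exact: straight_passages.
by rewrite mule_ge0 ?(EZ_ge0 _ nA.1) // lee_fin mulr_ge0 ?joint_weight_ge0 ?powR_ge0.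
Qed.

End Moments.

(** * Existence of the exponent *)

(** Writing [n] as a multiple of [N + 1] plus a bounded remainder, [u n / n] is at
    most [u (N + 1) / (N + 1)] up to [O(1 / n)]. *)
Lemma fekete (R : realType) (u : nat -> R) (c : R) :
  (forall n m, u (n.+1 + m.+1)%N <= u n.+1 + u m.+1) ->
  (forall n, c * n.+1%:R <= u n.+1) ->
  exists l : R, u n / n%:R @[n --> \oo] --> l.
Proof.
move=> sub low.
pose E := [set u n.+1 / n.+1%:R | n in [set: nat]].
have lbE : lbound E c.
  by move=> _ [n _ <-]; rewrite ler_pdivlMr ?ltr0n.
have infE : has_inf E by split; [exists (u 1%N / 1); exists 0%N|exists c].
exists (inf E); apply/cvgrPdist_lt => e e0.
have e2 : 0 < e / 2 by rewrite divr_gt0.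
have [_ [N _ <-] uN] := inf_adherent e2 infE.
pose B := \sum_(i < N.+1) `|u i.+1|.
have B0 : 0 <= B by apply: sumr_ge0.
have uB r : (r <= N)%N -> u r.+1 <= B.
  move=> rN; rewrite /B (bigD1 (Ordinal (rN : (r < N.+1)%N))) //=.
  by rewrite (le_trans (ler_norm _)) // lerDl sumr_ge0.
(* Euclidean division of [n] by [N + 1] with a remainder between [1] and [N + 1]. *)
have mult a r : (r <= N)%N ->
    u (a * N.+1 + r.+1)%N <= a%:R * u N.+1 + u r.+1.
  move=> rN; elim: a => [|a IH]; first by rewrite mul0n add0n mul0r add0r.
  have -> : (a.+1 * N.+1 + r.+1 = N.+1 + (a * N.+1 + r).+1)%N by rewrite mulSn addnS -addnA addnS.
  apply: le_trans (sub _ _) _; move: IH; rewrite addnS => IH.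
  by rewrite -natr1 mulrDl mul1r; lra.
pose C := B + N.+1%:R * `|u N.+1 / N.+1%:R|.
have C0 : 0 <= C by rewrite addr_ge0 // mulr_ge0.
have [M CM] : exists M : nat, C / (e / 2) < M%:R.
  exists (Num.bound (C / (e / 2))).
  by rewrite archi_boundP // divr_ge0 // ltW.
exists M.+1 => // n /= nM; have n0 : (0 < n)%N by lia.
have nR : 0 < n%:R :> R by rewrite ltr0n.
have Ele : inf E <= u n / n%:R.
  by apply: inf_lbound; [exists c|exists n.-1; rewrite // prednK].
rewrite distrC ger0_norm ?subr_ge0 // ltrBlDr.
have [a [r [rN nE]]] : exists a r, (r <= N)%N /\ (n = a * N.+1 + r.+1)%N.
  exists (n.-1 %/ N.+1)%N, (n.-1 %% N.+1)%N; split; first by rewrite -ltnS ltn_pmod.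
  by rewrite addnS -divn_eq prednK.
set v := u N.+1 / N.+1%:R in uN C C0 CM *.
have uv : u N.+1 = v * N.+1%:R by rewrite divfK // pnatr_eq0.
have unB : u n <= a%:R * (v * N.+1%:R) + B.
  rewrite -uv nE; apply: le_trans (mult a r rN) _.
  by rewrite lerD2l uB.
have aN : a%:R * (v * N.+1%:R) = v * n%:R - v * r.+1%:R.
  by rewrite nE natrD natrM; ring.
have vr : - (v * r.+1%:R) <= N.+1%:R * `|v|.
  apply: le_trans (ler_norm _) _; rewrite normrN normrM mulrC.
  by rewrite (ger0_norm (ler0n _ _)) ler_wpM2r // ler_nat.
have CeM : C < e / 2 * n%:R.
  have : C / (e / 2) < n%:R by apply: lt_trans CM _; rewrite ltr_nat.
  by rewrite ltr_pdivrMr // mulrC.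
rewrite ltr_pdivrMr // ; move: uN; rewrite -ltrBlDr => uN.
have : v * n%:R < (e / 2 + inf E) * n%:R.
  by rewrite ltr_pM2r //; lra.
rewrite /C in CeM; rewrite aN in unB.
have -> : (e + inf E) * n%:R = (e / 2 + inf E) * n%:R + e / 2 * n%:R by field.
by lra.
Qed.

Theorem proposition2p3 (R : realType) (d L k : nat) (p lam : R)
    (hd : (1 <= d)%N) (hL : (1 <= L)%N) (hk : (1 <= k)%N)
    (hp : 1 / 2 < p < 1) (hlam : 0 < lam)
    (disp1 : measure_display) (Om1 : measurableType disp1)
    (P1 : site d L -> probability Om1 R) (S : nat -> Om1 -> site d L)
    (hS : forall x, random_walk p (P1 x) S x)
    (disp : measure_display) (Om : measurableType disp)
    (P : ('I_k -> site d L) -> probability Om R)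
    (W : 'I_k -> nat -> Om -> site d L)
    (hW : forall x, independent_walks p (P x) W x)
    (hnice : exists Gam : 'I_k -> int -> seq (site d L), nice P1 S Gam) :
  exists xi : R,
    (fun n : nat => lne (q P1 S P W lam n) * (n%:R^-1)%:E)%E @ \oo
      --> (- xi)%:E.
Proof.
have [Q QE] : exists Q : nat -> R, forall n, q P1 S P W lam n = (Q n)%:E.
  exists (fun n => fine (q P1 S P W lam n)) => n.
  rewrite fineK // ge0_fin_numE; last exact: (q_ge0 lam hd hp hW n hnice).
  exact: le_lt_trans (q_le1 hd hk hp hlam hS hW n) (ltry _).
have Qge n : one_level_bound d k p lam ^+ n.+1 <= Q n.+1.
  have [Gam nG] := hnice; rewrite -lee_fin -QE.
  exact: le_trans (EZ_ge hd hk hp hlam hS hW n nG) (EZ_le_q _ _ _ _ nG).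
have g0 : 0 < one_level_bound d k p lam := one_level_bound_gt0 k lam hd hp.
have Q0 n : 0 < Q n.+1 by apply: lt_le_trans (Qge n); rewrite exprn_gt0.
have Qsub n m : Q (n.+1 + m)%N <= Q n.+1 * Q m.
  rewrite -lee_fin EFinM -!QE.
  exact: (q_submultiplicative hd hk hp hlam hS hW).
have sub n m : ln (Q (n.+1 + m.+1)%N) <= ln (Q n.+1) + ln (Q m.+1).
  rewrite -lnM ?posrE ?Q0 // ler_ln ?posrE; [exact: Qsub|exact: Q0|].
  by rewrite mulr_gt0.
have low n : ln (one_level_bound d k p lam) * n.+1%:R <= ln (Q n.+1).
  by rewrite mulr_natr -lnXn // ler_ln ?posrE ?exprn_gt0.
have [l Hl] := @fekete R (fun n => ln (Q n)) _ sub low.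
exists (- l); rewrite opprK.
have H : (ln (Q n) / n%:R)%:E @[n --> \oo] --> l%:E.
  by apply: cvg_EFin Hl; apply: nearW.
apply: cvg_trans H; apply: near_eq_cvg; exists 1%N => // -[|n] // _.
by rewrite QE lne_EFin // EFinM.
Qed.
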